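(* Let $f=(f_1,\ldots,f_r)$ be an $r$-tuple of restricted power series over $\mathbb{Q}_p$ in the variables $x=(x_1,\ldots,x_n)$, let $\psi$ be a nontrivial additive character on $\mathbb{Q}_p$, and for $y\in\mathbb{Q}_p^r$ put \[ E_f(y)=\int_{\mathbb{Z}_p^n}\psi\Big(\sum_{j=1}^r y_jf_j(x)\Big)\,|dx|. \] If $f(\mathbb{Z}_p^n)$ has nonempty interior in $\mathbb{Q}_p^r$, then there exist real numbers $\alpha<0$ and $c>0$ such that $|E_f(y)|\le c\min\{|y|^{\alpha},1\}$ for all $y\in\mathbb{Q}_p^r$ (with the convention $0^{\alpha}=+\infty$).
   Context: A restricted power series over $\mathbb{Q}_p$ in $n$ variables is a power series with coefficients in $\mathbb{Q}_p$ which converges on $\mathbb{Z}_p^n$. $|dx|$ denotes the Haar measure on $\mathbb{Q}_p^n$ normalized so that $\mathbb{Z}_p^n$ has measure $1$. For $y=(y_1,\ldots,y_r)\in\mathbb{Q}_p^r$, $|y|=\max_i|y_i|$ where $|\cdot|$ is the $p$-adic absolute value. *)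

(* Defs.v *)
From HB Require Import structures.
From mathcomp Require Import all_boot all_order all_algebra fraction finmap.
From mathcomp Require Import all_classical all_reals all_analysis.
From mathcomp Require Import summability complex.

Set Implicit Arguments.
Unset Strict Implicit.
Unset Printing Implicit Defensive.

Import Order.TTheory GRing.Theory Num.Theory.
Import numFieldNormedType.Exports.

Local Open Scope classical_set_scope.
Local Open Scope ring_scope.

(* Z_p is the projective limit of the Z/p^k: an element is the compatible
   sequence of its residues modulo p^k, represented in {0, ..., p^k - 1}.
   Compatibility at k forces pseq k < p ^ k. *)
Record padic_int (p : nat) (p_pr : prime p) := PadicInt {
  pseq :> nat -> nat;
  _ : `[< forall k, pseq k = pseq k.+1 %% p ^ k >]%N }.

Section PadicInt.
Variables (p : nat) (p_pr : prime p).
Local Open Scope nat_scope.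
Local Notation padic_int := (padic_int p_pr).

HB.instance Definition _ := [isSub for @pseq p p_pr].
HB.instance Definition _ := [Choice of padic_int by <:].

Implicit Types x y z : padic_int.

Lemma pseqS x k : x k = x k.+1 %% p ^ k.
Proof. by case: x => s /= /asboolP. Qed.

Lemma pexp_gt0 k : 0 < p ^ k.
Proof. by rewrite expn_gt0 prime_gt0. Qed.

Lemma pseq_lt x k : x k < p ^ k.
Proof. by rewrite pseqS ltn_pmod ?pexp_gt0. Qed.

Lemma pseq_mod x k : x k %% p ^ k = x k.
Proof. by rewrite modn_small ?pseq_lt. Qed.

Lemma pseq_modn x k l : k <= l -> x l %% p ^ k = x k.
Proof.
move=> /subnKC <-; elim: (l - k) => [|i IHi]; first by rewrite addn0 pseq_mod.
by rewrite -IHi (pseqS x (k + i)) modn_dvdm ?addnS// dvdn_exp2l ?leq_addr.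
Qed.

Lemma padic_int_eq x y : x =1 y -> x = y.
Proof. by move=> xy; apply/val_inj/funext. Qed.

Lemma mod_compat (s : nat -> nat) :
  (forall k, s k.+1 = s k %[mod p ^ k]) ->
  `[< forall k, s k %% p ^ k = (s k.+1 %% p ^ k.+1) %% p ^ k >].
Proof.
by move=> sP; apply/asboolP => k; rewrite modn_dvdm ?sP// dvdn_exp2l.
Qed.

Definition padic_int_mk s sP : padic_int :=
  PadicInt p_pr (@mod_compat s sP).

Lemma pseqS_eqmod x k : x k.+1 = x k %[mod p ^ k].
Proof. by rewrite pseq_mod -pseqS. Qed.

Lemma cst_eqmod (m k : nat) : m = m %[mod p ^ k].
Proof. by []. Qed.

Lemma add_eqmod x y k : x k.+1 + y k.+1 = x k + y k %[mod p ^ k].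
Proof. by rewrite -modnDm !pseqS_eqmod modnDm. Qed.

Lemma mul_eqmod x y k : x k.+1 * y k.+1 = x k * y k %[mod p ^ k].
Proof. by rewrite -modnMm !pseqS_eqmod modnMm. Qed.

Lemma opp_eqmod x k : p ^ k.+1 - x k.+1 = p ^ k - x k %[mod p ^ k].
Proof.
apply/eqP; rewrite -(eqn_modDr (x k.+1)) subnK ?(ltnW (pseq_lt _ _))//.
rewrite eq_sym -modnDmr pseqS_eqmod modnDmr subnK ?(ltnW (pseq_lt _ _))//.
by rewrite modnn expnS modnMl.
Qed.

Definition padic_int_nat (m : nat) := padic_int_mk (cst_eqmod m).
Definition padic_int_add x y := padic_int_mk (add_eqmod x y).
Definition padic_int_mul x y := padic_int_mk (mul_eqmod x y).
Definition padic_int_opp x := padic_int_mk (opp_eqmod x).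

Lemma padic_int_addA : associative padic_int_add.
Proof.
by move=> x y z; apply: padic_int_eq => k /=; rewrite modnDml modnDmr addnA.
Qed.

Lemma padic_int_addC : commutative padic_int_add.
Proof. by move=> x y; apply: padic_int_eq => k /=; rewrite addnC. Qed.

Lemma padic_int_add0 : left_id (padic_int_nat 0) padic_int_add.
Proof.
by move=> x; apply: padic_int_eq => k /=; rewrite modnDml add0n pseq_mod.
Qed.

Lemma padic_int_addN :
  left_inverse (padic_int_nat 0) padic_int_opp padic_int_add.
Proof.
move=> x; apply: padic_int_eq => k /=.
by rewrite modnDml subnK ?(ltnW (pseq_lt _ _))// modnn mod0n.
Qed.

HB.instance Definition _ := GRing.isZmodule.Build padic_int
  padic_int_addA padic_int_addC padic_int_add0 padic_int_addN.

Lemma padic_int_mulA : associative padic_int_mul.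
Proof.
by move=> x y z; apply: padic_int_eq => k /=; rewrite modnMml modnMmr mulnA.
Qed.

Lemma padic_int_mulC : commutative padic_int_mul.
Proof. by move=> x y; apply: padic_int_eq => k /=; rewrite mulnC. Qed.

Lemma padic_int_mul1 : left_id (padic_int_nat 1) padic_int_mul.
Proof.
by move=> x; apply: padic_int_eq => k /=; rewrite modnMml mul1n pseq_mod.
Qed.

Lemma padic_int_mulDl : left_distributive padic_int_mul padic_int_add.
Proof.
move=> x y z; apply: padic_int_eq => k /=.
by rewrite modnMml modnDml modnDmr mulnDl.
Qed.

Lemma padic_int_oner_neq0 : padic_int_nat 1 != 0%R.
Proof.
apply/eqP => /(congr1 (fun x : padic_int => x 1)) /=.
by rewrite expn1 mod0n modn_small ?prime_gt1.
Qed.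

HB.instance Definition _ := GRing.Zmodule_isComNzRing.Build padic_int
  padic_int_mulA padic_int_mulC padic_int_mul1 padic_int_mulDl
  padic_int_oner_neq0.

Definition padic_int_unit : {pred padic_int} :=
  fun x => `[< exists y, (y * x = 1)%R >].

Definition padic_int_inv x : padic_int :=
  if x \in padic_int_unit then xget x [set y | (y * x = 1)%R] else x.

Lemma padic_int_mulVx :
  {in padic_int_unit, left_inverse 1%R padic_int_inv *%R}.
Proof.
move=> x xu; rewrite /padic_int_inv xu.
by move: xu => /asboolP[y yx]; case: xgetP => // /(_ y).
Qed.

Lemma padic_int_unitPl x y : (y * x = 1)%R -> x \in padic_int_unit.
Proof. by move=> yx; apply/asboolP; exists y. Qed.

Lemma padic_int_invr_out : {in [predC padic_int_unit], padic_int_inv =1 id}.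
Proof. by move=> x; rewrite inE /padic_int_inv => /negPf ->. Qed.

HB.instance Definition _ := GRing.ComNzRing_hasMulInverse.Build padic_int
  padic_int_mulVx padic_int_unitPl padic_int_invr_out.

(* The p-adic valuation of x; the value 0 at x = 0 is irrelevant. *)
Definition padic_int_val x : nat := xget 0 [set k | x k = 0 /\ x k.+1 != 0].

Lemma pseq0 k : (0%R : padic_int) k = 0.
Proof. exact: mod0n. Qed.

Lemma pseq_at0 x : x 0 = 0.
Proof. by have := pseq_lt x 0; rewrite expn0; case: (x 0). Qed.

Lemma pseq_le0 x k l : k <= l -> x l = 0 -> x k = 0.
Proof. by move=> kl xl0; rewrite -(pseq_modn x kl) xl0 mod0n. Qed.

Lemma padic_int_valP x :
  x != 0%R -> x (padic_int_val x) = 0 /\ x (padic_int_val x).+1 != 0.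
Proof.
move=> x0; rewrite /padic_int_val; case: xgetP => [k -> []//|H]; exfalso.
move/eqP: x0; apply; apply: padic_int_eq => k; rewrite pseq0.
elim: k => [|k IHk]; first exact: pseq_at0.
by have [//|xk] := eqVneq (x k.+1) 0; case: (H k).
Qed.

Lemma padic_int_val_le x k : x != 0%R -> (x k == 0) = (k <= padic_int_val x).
Proof.
move=> /padic_int_valP[x0 xS]; apply/eqP/idP => [xk|/pseq_le0]; last exact.
by rewrite leqNgt; apply: contra xS => /pseq_le0 ->.
Qed.

Lemma padic_int_val_uniq x k : x k = 0 -> x k.+1 != 0 -> padic_int_val x = k.
Proof.
move=> xk xS; have x0 : x != 0%R by apply: contraNneq xS => ->; rewrite pseq0.
apply/eqP; rewrite eqn_leq -padic_int_val_le// xk eqxx andbT.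
by rewrite leqNgt -padic_int_val_le.
Qed.

Lemma pseq_logn x k : x != 0%R -> padic_int_val x < k ->
  x k != 0 /\ logn p (x k) = padic_int_val x.
Proof.
move=> x0 vk; have xk : x k != 0 by rewrite padic_int_val_le// -ltnNge.
split => //; have xk_gt0 : 0 < x k by rewrite lt0n.
apply/eqP; rewrite eqn_leq -pfactor_dvdn// leqNgt -pfactor_dvdn//.
rewrite /dvdn !pseq_modn ?(ltnW vk)//.
by case: (padic_int_valP x0) => -> ->; rewrite eqxx.
Qed.

Lemma padic_int_valM x y : x != 0%R -> y != 0%R ->
  (x * y != 0)%R /\
  padic_int_val (x * y)%R = padic_int_val x + padic_int_val y.
Proof.
move=> x0 y0; set v := padic_int_val x; set w := padic_int_val y.
have [xk xl] : x (v + w).+1 != 0 /\ logn p (x (v + w).+1) = v.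
  by apply: pseq_logn; rewrite ?ltnS ?leq_addr.
have [yk yl] : y (v + w).+1 != 0 /\ logn p (y (v + w).+1) = w.
  by apply: pseq_logn; rewrite ?ltnS ?leq_addl.
have xyS : (x * y)%R (v + w).+1 != 0.
  rewrite -[_ _.+1]/((x (v + w).+1 * y (v + w).+1) %% p ^ (v + w).+1).
  rewrite -/(dvdn _ _) pfactor_dvdn ?muln_gt0 ?lt0n ?xk ?yk//.
  by rewrite lognM ?lt0n// xl yl ltnn.
have xy0 : (x * y)%R (v + w) = 0.
  apply/eqP; rewrite -[_ (v + w)]/((x (v + w) * y (v + w)) %% p ^ (v + w)).
  rewrite -/(dvdn _ _) expnD dvdn_mul// /dvdn pseq_modn ?leq_addr ?leq_addl//.
    by case: (padic_int_valP x0) => ->.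
  by case: (padic_int_valP y0) => ->.
split; last exact: padic_int_val_uniq.
by apply: contraNneq xyS => ->; rewrite pseq0.
Qed.

Lemma padic_int_idomain x y : (x * y = 0)%R -> (x == 0%R) || (y == 0%R).
Proof.
move=> xy0; have [//|x0 /=] := eqVneq x 0%R; have [//|y0 /=] := eqVneq y 0%R.
by have [] := padic_int_valM x0 y0; rewrite xy0 eqxx.
Qed.

HB.instance Definition _ :=
  GRing.ComUnitRing_isIntegral.Build padic_int padic_int_idomain.

End PadicInt.

Section Padic.
Variables (p : nat) (p_pr : prime p).

Definition padic := {fraction (padic_int p_pr)}.

HB.instance Definition _ := GRing.Field.on padic.

Definition padic_of_int (a : padic_int p_pr) : padic := FracField.tofrac a.

HB.instance Definition _ := GRing.isZmodMorphism.Build (padic_int p_pr) padic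
  padic_of_int (@tofrac_is_zmod_morphism _).
HB.instance Definition _ := GRing.isMonoidMorphism.Build (padic_int p_pr) padic
  padic_of_int (@tofrac_is_monoid_morphism _).

Lemma padic_of_int_eq0 a : (padic_of_int a == 0) = (a == 0).
Proof. exact: tofrac_eq0. Qed.

Definition padic_num (x : padic) : padic_int p_pr := (frac (repr x)).1.
Definition padic_den (x : padic) : padic_int p_pr := (frac (repr x)).2.

Lemma padic_den_neq0 x : padic_den x != 0.
Proof. exact: denom_ratioP. Qed.

Lemma padic_numden x :
  x = padic_of_int (padic_num x) / padic_of_int (padic_den x).
Proof.
have d0 : padic_of_int (padic_den x) != 0.
  by rewrite padic_of_int_eq0 padic_den_neq0.
apply: (mulIf d0); rewrite divfK// -{1}[x]reprK /padic_of_int.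
unlock FracField.tofrac; rewrite -[LHS]FracField.pi_mul; apply/eqmodP => /=.
rewrite /FracField.equivf /FracField.mulf /= !numden_Ratio ?oner_neq0 ?mulr1//.
- by rewrite mulrC.
- exact: padic_den_neq0.
- exact: padic_den_neq0.
Qed.

Section Abs.
Variable K : realFieldType.

Definition padic_int_abs (a : padic_int p_pr) : K :=
  if a == 0 then 0 else p%:R ^- padic_int_val a.

(* The choice of the representing fraction is irrelevant, see padic_absE. *)
Definition padic_abs (x : padic) : K :=
  padic_int_abs (padic_num x) / padic_int_abs (padic_den x).

Let p_gt0 : 0 < p%:R :> K.
Proof. by rewrite ltr0n prime_gt0. Qed.

Lemma padic_int_abs_eq0 a : (padic_int_abs a == 0) = (a == 0).
Proof.
rewrite /padic_int_abs; case: (eqVneq a 0) => _; first exact: eqxx.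
by rewrite gt_eqF// invr_gt0 exprn_gt0.
Qed.

Lemma padic_int_abs_ge0 a : 0 <= padic_int_abs a.
Proof.
by rewrite /padic_int_abs; case: ifP => // _; rewrite invr_ge0 exprn_ge0// ltW.
Qed.

Lemma padic_int_absM a b :
  padic_int_abs (a * b) = padic_int_abs a * padic_int_abs b.
Proof.
rewrite /padic_int_abs; have [->|a0] := eqVneq a 0.
  by rewrite !mul0r eqxx.
have [->|b0] := eqVneq b 0; first by rewrite !mulr0 eqxx.
have [/negPf -> ->] := padic_int_valM a0 b0.
by rewrite exprD invfM.
Qed.

Lemma padic_int_absN a : padic_int_abs (- a) = padic_int_abs a.
Proof.
rewrite -mulN1r padic_int_absM; suff -> : padic_int_abs (-1) = 1 by rewrite mul1r.
rewrite /padic_int_abs oppr_eq0 oner_eq0.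
rewrite (_ : padic_int_val _ = 0%N) ?expr0 ?invr1//.
apply: padic_int_val_uniq; first exact: pseq_at0.
apply/eqP => N1; have := congr1 (fun x : padic_int p_pr => x 1%N) (addNr 1).
rewrite -[LHS]/((pseq (-1)%R 1 + pseq 1%R 1) %% p ^ 1)%N N1 add0n pseq_mod.
by rewrite pseq0 -[pseq 1%R 1%N]/(1 %% p ^ 1)%N expn1 modn_small ?prime_gt1.
Qed.

Lemma padic_int_abs_le a k :
  (padic_int_abs a <= p%:R ^- k) = (pseq a k == 0%N).
Proof.
rewrite /padic_int_abs; have [->|a0] := eqVneq a 0.
  by rewrite pseq0 eqxx invr_ge0 exprn_ge0// ltW.
rewrite padic_int_val_le// lef_pV2 ?posrE ?exprn_gt0//.
by rewrite ler_eXn2l// ltr1n prime_gt1.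
Qed.

Lemma padic_int_abs_le1 a : padic_int_abs a <= 1.
Proof.
by have := padic_int_abs_le a 0; rewrite expr0 invr1 => ->; rewrite pseq_at0.
Qed.

Lemma padic_int_abs_ultra a b :
  padic_int_abs (a + b) <= Num.max (padic_int_abs a) (padic_int_abs b).
Proof.
suff H x y : padic_int_abs x <= padic_int_abs y ->
    padic_int_abs (x + y) <= padic_int_abs y.
  have [ab|/ltW ba] := leP (padic_int_abs a) (padic_int_abs b).
    exact: H.
  by rewrite addrC H.
have [->|y0] := eqVneq y 0.
  by rewrite addr0.
have -> : padic_int_abs y = p%:R ^- padic_int_val y.
  by rewrite /padic_int_abs (negPf y0).
rewrite !padic_int_abs_le => /eqP xv; have [yv _] := padic_int_valP y0.
by rewrite -[pseq _ _]/((pseq x _ + pseq y _) %% _)%N xv yv mod0n.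
Qed.

Lemma padic_absE a b : b != 0 ->
  padic_abs (padic_of_int a / padic_of_int b) =
  padic_int_abs a / padic_int_abs b.
Proof.
move=> b0; set x := _ / _; rewrite /padic_abs.
apply/eqP; rewrite eqr_div ?padic_int_abs_eq0 ?padic_den_neq0//.
rewrite -!padic_int_absM; apply/eqP; congr padic_int_abs.
have d0 := padic_den_neq0 x.
apply/eqP; rewrite -subr_eq0 -padic_of_int_eq0 rmorphB !rmorphM subr_eq0.
by rewrite -eqr_div ?padic_of_int_eq0// -padic_numden.
Qed.

Lemma padic_abs_int a : padic_abs (padic_of_int a) = padic_int_abs a.
Proof.
have abs1 : padic_int_abs 1 = 1.
  have := padic_int_absM 1 1; rewrite mulr1 => /eqP.
  rewrite -[X in X == _]mulr1 => /eqP/mulfI -> //.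
  by rewrite padic_int_abs_eq0 oner_neq0.
have := @padic_absE a 1 (oner_neq0 _).
by rewrite rmorph1 divr1 abs1 divr1.
Qed.

Lemma padic_abs_ge0 x : 0 <= padic_abs x.
Proof. by rewrite divr_ge0 ?padic_int_abs_ge0. Qed.

Lemma padic_abs_eq0 x : (padic_abs x == 0) = (x == 0).
Proof.
rewrite [in RHS](padic_numden x) !mulf_eq0 !invr_eq0 !padic_int_abs_eq0.
by rewrite !padic_of_int_eq0.
Qed.

Lemma padic_absM x y : padic_abs (x * y) = padic_abs x * padic_abs y.
Proof.
rewrite [in LHS](padic_numden x) [in LHS](padic_numden y) mulf_div -!rmorphM.
rewrite padic_absE ?mulf_neq0 ?padic_den_neq0//.
by rewrite !padic_int_absM -mulf_div.
Qed.

Lemma padic_absN x : padic_abs (- x) = padic_abs x.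
Proof.
rewrite [in LHS](padic_numden x) -mulNr -rmorphN.
by rewrite padic_absE ?padic_den_neq0// padic_int_absN.
Qed.

Lemma padic_abs_ultra x y :
  padic_abs (x + y) <= Num.max (padic_abs x) (padic_abs y).
Proof.
have absd0 z : 0 < padic_int_abs (padic_den z).
  by rewrite lt_def padic_int_abs_ge0 padic_int_abs_eq0 padic_den_neq0.
rewrite [in leLHS](padic_numden x) [in leLHS](padic_numden y).
rewrite addf_div ?padic_of_int_eq0 ?padic_den_neq0// -!rmorphM -rmorphD.
rewrite padic_absE ?mulf_neq0 ?padic_den_neq0//.
rewrite ler_pdivrMr ?padic_int_absM ?mulr_gt0 ?absd0//.
apply: le_trans (padic_int_abs_ultra _ _) _.
have E (u v w : K) : 0 < w -> u / w * (w * v) = u * v.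
  by move=> w0; rewrite mulrA divfK ?gt_eqF.
rewrite maxr_pMl ?mulr_ge0 ?padic_int_abs_ge0// /padic_abs !padic_int_absM.
rewrite E ?absd0// [X in _ <= Num.max _ (_ * X)]mulrC E ?absd0//.
Qed.

Lemma padic_abs_p : padic_abs p%:R = p%:R^-1.
Proof.
rewrite -(rmorph_nat padic_of_int) padic_abs_int /padic_int_abs.
have pE m k : pseq (m%:R : padic_int p_pr) k = (m %% p ^ k)%N.
  elim: m => [|m IHm]; first by rewrite pseq0 mod0n.
  rewrite mulrS -[LHS]/((1 %% p ^ k + pseq (m%:R : padic_int p_pr) k) %% p ^ k)%N.
  by rewrite IHm modnDm add1n.
have v1 : padic_int_val (p%:R : padic_int p_pr) = 1%N.
  apply: padic_int_val_uniq; rewrite pE ?expn1 ?modnn//.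
  by rewrite modn_small ?ltn_Pmull ?prime_gt1 ?prime_gt0// -lt0n prime_gt0.
case: eqVneq => [p0|_]; last by rewrite v1 expr1.
have := pE p 2%N; rewrite p0 pseq0 modn_small; last first.
  by rewrite ltn_Pmull ?prime_gt1 ?prime_gt0.
by move=> p0'; have := prime_gt0 p_pr; rewrite -p0'.
Qed.

Lemma padic_abs_dist_triangle (y x z : padic) :
  padic_abs (x - z) <= padic_abs (x - y) + padic_abs (y - z).
Proof.
rewrite -[x - z](subrKA y) (le_trans (padic_abs_ultra _ _))//.
by rewrite ge_max lerDl lerDr !padic_abs_ge0.
Qed.

End Abs.

Let dist (x y : padic) : rat := padic_abs rat (x - y).

Let distxx x : dist x x = 0.
Proof. by apply/eqP; rewrite /dist padic_abs_eq0 subrr. Qed.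

Let dist_eq0 x y : dist x y = 0 -> x = y.
Proof. by move=> /eqP; rewrite /dist padic_abs_eq0 subr_eq0 => /eqP. Qed.

Let dist_sym x y : dist x y = dist y x.
Proof. by rewrite /dist -padic_absN opprB. Qed.

HB.instance Definition _ := isPointed.Build padic 0.

(* The p-adic absolute value takes its values in p^Z together with 0, so the
   p-adic metric is rational-valued. *)
HB.instance Definition _ := isMetric.Build rat padic
  distxx dist_eq0 dist_sym (@padic_abs_dist_triangle rat).

Lemma padic_hausdorff : hausdorff_space padic.
Proof. exact: metric_hausdorff. Qed.

End Padic.

Section Integral.
Variables (p : nat) (p_pr : prime p).
Local Notation Qp := (padic p_pr).

Definition padic_intset : set Qp := range (@padic_of_int p p_pr).

Definition padic_intcube n : set 'rV[Qp]_n :=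
  [set x | forall i, padic_intset (x ord0 i)].
Arguments padic_intcube : clear implicits.

Definition vec_abs (K : realFieldType) n (y : 'rV[Qp]_n) : K :=
  \big[Num.max/0]_(i < n) padic_abs K (y ord0 i).

(* A power series in n variables is its family of coefficients, indexed by
   multi-exponents. *)
Definition power_series n := {ffun 'I_n -> nat} -> Qp.

Section PowerSeries.
Variable n : nat.
Implicit Types (a : power_series n) (x : 'rV[Qp]_n).

Definition series_term a x (i : {ffun 'I_n -> nat}) : Qp :=
  a i * \prod_(k < n) x ord0 k ^+ i k.

(* The sum is taken along the filter of finite sets of multi-exponents. *)
Definition series_cvg a x := cvg (partial_sum (series_term a x) @ totally).

Definition series_eval a x : Qp := lim (partial_sum (series_term a x) @ totally).

Definition restricted a := forall x, padic_intcube n x -> series_cvg a x.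

Definition series_map r (f : 'I_r -> power_series n) x : 'rV[Qp]_r :=
  \row_j series_eval (f j) x.

End PowerSeries.

Definition borel_padic n := g_sigma_algebraType (@open 'rV[Qp]_n).

Variable R : realType.

Definition normalized_haar n (mu : {measure set (borel_padic n) -> \bar R}) :=
  (forall (v : 'rV[Qp]_n) (A : set (borel_padic n)), measurable A ->
     mu [set v + x | x in A] = mu A) /\
  mu (padic_intcube n) = 1%E.

(* Characters are unitary, as usual for characters of locally compact abelian
   groups. *)
Definition additive_character (psi : Qp -> R[i]) :=
  [/\ continuous (psi : Qp -> R[i]^o),
      forall a b, psi (a + b) = psi a * psi b
    & forall a, `|psi a| = 1].

Definition exp_integral n r (mu : {measure set (borel_padic n) -> \bar R})
    (psi : Qp -> R[i]) (f : 'I_r -> power_series n) (y : 'rV[Qp]_r) : R[i] :=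
  let g (x : 'rV[Qp]_n) := psi (\sum_(j < r) y ord0 j * series_eval (f j) x) in
  ((\int[mu]_(x in padic_intcube n) complex.Re (g x)) +i*
   (\int[mu]_(x in padic_intcube n) complex.Im (g x)))%C.

(* Real power of a nonnegative base, with 0 sent to +oo for every exponent. *)
Definition powR_pinfty (t alpha : R) : \bar R :=
  if t == 0 then +oo%E else (t `^ alpha)%:E.

End Integral.

Arguments padic_intset {p} p_pr.
Arguments padic_intcube {p} p_pr n.

(* Main.v *)
Require Import Defs.
From mathcomp Require Import all_boot all_order all_algebra finmap.
From mathcomp Require Import all_classical all_reals all_analysis complex.
From mathcomp Require Import zify ring lra summability cyclic.

Set Implicit Arguments.
Unset Strict Implicit.
Unset Printing Implicit Defensive.

Import Order.TTheory GRing.Theory Num.Theory.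
Import numFieldNormedType.Exports.

Local Open Scope classical_set_scope.
Local Open Scope ring_scope.

(* The image of [f] lies in no affine hyperplane, so no nontrivial combination
   of the [f_j] has all its nonconstant coefficients equal to zero. By linear
   algebra, for every primitive [w] some nonconstant coefficient of
   [g = sum_j w_j f_j] has absolute value bounded below independently of [w].
   Scale [f] to have integral coefficients and write [y = p^-v w] with [w]
   primitive. The integral is then the average of a character of [Z/p^M], whose
   kernel contains no nonzero ideal, over the values of [g] on [(Z/p^M)^n],
   where [M = v + O(1)]. Multiplying the variable [x_j] by [1 + p^(M/2) s] and
   averaging over [s] restricts this average to the points at which the Euler
   derivative [x_j dg/dx_j] is divisible by [p^(M/2)]. Translating along the
   curve [t |-> (t^(B^k))_k] turns that condition into congruences in one
   variable [t] in which a coefficient of controlled degree [K] has bounded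
   valuation and the later coefficients are smaller, so that the proportion of
   these points is [O(p^(- M / 2K))]. *)

(** * p-adic integers and the p-adic absolute value *)

Section PadicIntegers.
Variables (p : nat) (p_pr : prime p).
Local Notation Zp := (padic_int p_pr).
Implicit Types a b : Zp.

Lemma pseqD a b k : pseq (a + b) k = ((pseq a k + pseq b k) %% p ^ k)%N.
Proof. by []. Qed.

Lemma pseqM a b k : pseq (a * b) k = ((pseq a k * pseq b k) %% p ^ k)%N.
Proof. by []. Qed.

Lemma pseq1 k : pseq (1 : Zp) k = (1 %% p ^ k)%N.
Proof. by []. Qed.

Lemma pseq_nat m k : pseq (m%:R : Zp) k = (m %% p ^ k)%N.
Proof.
elim: m => [|m IHm]; first by rewrite pseq0 mod0n.
by rewrite mulrS pseqD IHm pseq1 modnDm add1n.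
Qed.

(** Dividing by [p ^ s] costs [s] digits, so the quotient modulo [p ^ k] is read off the residue of
    [a] at level [k + s]. *)
Lemma pseq_eq0P a s : reflect (exists b, a = p%:R ^+ s * b) (pseq a s == 0%N).
Proof.
apply: (iffP eqP) => [a0|[b ->]]; last first.
  by rewrite pseqM -natrX pseq_nat modnn mul0n mod0n.
have dvd k : (p ^ s %| pseq a (k + s))%N.
  by rewrite /dvdn pseq_modn ?leq_addl// a0.
pose u k := (pseq a (k + s) %/ p ^ s)%N.
have uE k : pseq a (k + s) = (u k * p ^ s)%N by rewrite divnK.
have uP k : (u k.+1 = u k %[mod p ^ k])%N.
  apply/eqP; rewrite -(eqn_pmul2r (pexp_gt0 p_pr s)) !muln_modl -!uE -expnD.
  by rewrite pseq_modn ?leq_add2r// pseq_mod.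
exists (padic_int_mk p_pr uP); apply: padic_int_eq => k.
rewrite pseqM -natrX pseq_nat -[pseq (padic_int_mk _ _) k]/(u k %% p ^ k)%N.
rewrite -(pseq_modn a (leq_addr s k)) uE modnMml modnMmr mulnC.
by [].
Qed.

(** Euler's theorem gives an inverse modulo each [p ^ k.+1]; since inverses modulo [p ^ k] are
    unique, the independent choices are compatible. *)
Lemma padic_int_unitP a : pseq a 1 != 0%N -> exists b, b * a = 1.
Proof.
move=> a1.
have cop k : coprime (pseq a k.+1) (p ^ k.+1).
  rewrite coprime_sym coprime_pexpl// prime_coprime// /dvdn.
  by rewrite -[X in (_ %% X)%N]expn1 pseq_modn.
have inv k : exists u, (u * pseq a k.+1 == 1 %[mod p ^ k.+1])%N.
  exists (pseq a k.+1 ^ (totient (p ^ k.+1)).-1)%N.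
  rewrite -expnSr prednK ?totient_gt0 ?expn_gt0 ?prime_gt0//.
  exact/eqP/Euler_exp_totient.
pose u k := xchoose (inv k).
pose w k := if k is k'.+1 then u k' else 0%N.
have wP k : (w k.+1 = w k %[mod p ^ k])%N.
  case: k => [|k]; first by rewrite expn0 !modn1.
  rewrite /w /u.
  move: (xchoose _) (eqP (xchooseP (inv k))) => u1 u1P.
  move: (xchoose _) (eqP (xchooseP (inv k.+1))) => u2.
  move/(congr1 (fun m => (m %% p ^ k.+1)%N)).
  rewrite !modn_dvdm ?dvdn_exp2l// -modnMmr -pseqS => u2P.
  rewrite -[u2]muln1 -modnMmr -u1P modnMmr mulnCA.
  by rewrite -modnMmr u2P modnMmr muln1.
exists (padic_int_mk p_pr wP); apply: padic_int_eq => -[|k].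
  by rewrite !pseq_at0.
rewrite pseqM pseq1 -[pseq (padic_int_mk _ _) _]/(u k %% _)%N modnMml.
exact/eqP/(xchooseP (inv k)).
Qed.

Lemma padic_int_val_factor a : a != 0 ->
  exists2 b, a = p%:R ^+ padic_int_val a * b & exists c, c * b = 1.
Proof.
move=> a0; have [/eqP av aS] := padic_int_valP a0.
have [b E] := pseq_eq0P _ _ av; exists b => //; apply: padic_int_unitP.
apply: contra aS => /pseq_eq0P[c bE].
by apply/pseq_eq0P; exists c; rewrite {1}E bE expr1 exprSr mulrA.
Qed.

(** The crude bound [m < p ^ m] controls the valuation of the integer factor that the Euler
    derivative brings in. *)
Lemma pseq_natl_neq0 m : (0 < m)%N -> pseq (m%:R : Zp) m != 0%N.
Proof.
move=> m0; have mp : (m < p ^ m)%N by apply: ltn_expl; exact: prime_gt1.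
by rewrite pseq_nat (modn_small mp) -lt0n.
Qed.

Lemma pseq_mul_neq0 a b s l : pseq a s.+1 != 0%N -> pseq b l.+1 != 0%N ->
  pseq (a * b) (s + l).+1 != 0%N.
Proof.
move=> aN bN.
have nz (c : Zp) k : pseq c k != 0%N -> c != 0.
  by apply: contraNneq => ->; rewrite pseq0.
have a0 := nz _ _ aN; have b0 := nz _ _ bN.
have [ab0 vab] := padic_int_valM a0 b0.
move: aN bN; rewrite !padic_int_val_le// vab; lia.
Qed.
End PadicIntegers.

Lemma padic_p_neq0 (p : nat) (p_pr : prime p) : (p%:R : padic p_pr) != 0.
Proof.
by rewrite -(padic_abs_eq0 rat) padic_abs_p invr_eq0 pnatr_eq0 -lt0n prime_gt0.
Qed.

Section PadicNumbers.
Variables (p : nat) (p_pr : prime p) (K : realFieldType).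
Local Notation Zp := (padic_int p_pr).
Local Notation Qp := (padic p_pr).
Local Notation abs := (padic_abs K).
Implicit Types x y : Qp.

Let pK_gt0 : 0 < p%:R :> K. Proof. by rewrite ltr0n prime_gt0. Qed.

Lemma padic_abs1 : abs (1 : Qp) = 1.
Proof.
have: abs (1 : Qp) != 0 by rewrite padic_abs_eq0 oner_eq0.
by move/mulfI; apply; rewrite -padic_absM !mulr1.
Qed.

Lemma padic_abs_pexp (m : int) : abs ((p%:R : Qp) ^ m) = p%:R ^ (- m).
Proof.
have nat_case k : abs ((p%:R : Qp) ^+ k) = p%:R ^- k.
  elim: k => [|k IHk]; first by rewrite !expr0 padic_abs1 invr1.
  by rewrite !exprS padic_absM IHk padic_abs_p invfM.
case: m => k; first by rewrite -exprnP nat_case -exprnN.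
rewrite NegzE opprK -exprnN -exprnP.
have e0 : (p%:R : Qp) ^+ k.+1 != 0 by rewrite expf_neq0 ?padic_p_neq0.
have := padic_absM K (p%:R ^- k.+1) ((p%:R : Qp) ^+ k.+1).
rewrite mulVf// padic_abs1 nat_case => /esym E.
by rewrite -[LHS]mulr1 -[X in _ * X](mulVf (expf_neq0 k.+1 (lt0r_neq0
  pK_gt0))) mulrA E mul1r.
Qed.

Lemma padic_abs_pow x : x != 0 -> exists m : int, abs x = p%:R ^ m.
Proof.
move=> x0; pose a := padic_num x; pose b := padic_den x.
have b0 : b != 0 by apply: padic_den_neq0.
have a0 : a != 0.
  by apply: contra_neq x0 => a0; rewrite [x]padic_numden -/a a0 rmorph0 mul0r.
exists ((padic_int_val b)%:Z - (padic_int_val a)%:Z).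
rewrite [x]padic_numden padic_absE//
  /padic_int_abs -/a -/b (negPf a0) (negPf b0).
by rewrite invrK addrC expfzDr ?gt_eqF// -exprnN.
Qed.

(** In a fraction of absolute value at most 1, the power of [p] in the denominator divides the
    numerator, and the rest of the denominator is a unit. *)
Lemma padic_abs_le1P x : reflect (exists a, x = padic_of_int a) (abs x <= 1).
Proof.
apply: (iffP idP) => [|[a ->]]; last first.
  by rewrite padic_abs_int padic_int_abs_le1.
pose a := padic_num x; pose b := padic_den x.
have b0 : b != 0 by apply: padic_den_neq0.
rewrite [in X in X -> _](padic_numden x) padic_absE// ler_pdivrMr ?mul1r;
  last first.
  by rewrite lt_def padic_int_abs_ge0 padic_int_abs_eq0 b0.
rewrite -/a -/b {2}/padic_int_abs (negPf b0) padic_int_abs_le =>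
  /pseq_eq0P[a' aE].
have [b' bE [c cb]] := padic_int_val_factor b0.
exists (a' * c); rewrite [x]padic_numden -/a -/b.
have ob0 : padic_of_int b != 0 by rewrite padic_of_int_eq0.
apply: (mulIf ob0); rewrite divfK// -rmorphM aE {2}bE.
congr padic_of_int; rewrite mulrC -[RHS]mulrA; congr (_ * _).
by rewrite mulrCA cb mulr1.
Qed.

Lemma padic_abs_le_pow x (m : int) :
  reflect (exists a, x = p%:R ^ m * padic_of_int a) (abs x <= p%:R ^ (- m)).
Proof.
have pm0 : (p%:R : Qp) ^ m != 0 by rewrite expfz_neq0 ?padic_p_neq0.
have E : (abs x <= p%:R ^ (- m)) = (abs (p%:R ^ (- m) * x) <= 1).
  rewrite padic_absM padic_abs_pexp opprK mulrC.
  by rewrite -[RHS]ler_pdivlMr ?exprz_gt0// div1r invr_expz.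
rewrite E; apply: (iffP (padic_abs_le1P _)) => -[a aE]; exists a.
  by rewrite -aE mulrA -invr_expz mulfV// mul1r.
by rewrite aE mulrA -invr_expz mulVf// mul1r.
Qed.
End PadicNumbers.

(** * Polynomial congruences modulo a prime power *)

Section IntegersModPrimePower.
Variables (p : nat) (p_pr : prime p) (M : nat) (M_gt0 : (0 < M)%N).
Local Notation Q := ('Z_(p ^ M)).
Implicit Types (a b z : Q) (s l e : nat).

Lemma modulus_gt1 : (1 < p ^ M)%N.
Proof. by rewrite -(expn0 p) ltn_exp2l// prime_gt1. Qed.

Lemma card_mod : #|{: Q}| = (p ^ M)%N.
Proof. by rewrite card_ord Zp_cast// modulus_gt1. Qed.

(** Divisibility of the representative as a natural number, so that valuations can be computed with
    [logn]. *)
Definition pdvd s z := (p ^ s %| z)%N.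

Lemma pdvdP s z : (s <= M)%N ->
  reflect (exists w, z = p%:R ^+ s * w) (pdvd s z).
Proof.
move=> sM; apply: (iffP idP) => [/dvdnP[k zE]|[w ->]].
  by exists k%:R; rewrite -natrX -natrM mulnC -zE natr_Zp.
rewrite -natrX -[w]natr_Zp -natrM /pdvd val_Zp_nat ?modulus_gt1//.
by rewrite /dvdn modn_dvdm ?dvdn_exp2l// modnMr.
Qed.

Lemma pdvd_leq s l z : (s <= l)%N -> pdvd l z -> pdvd s z.
Proof. by move=> sl; apply: dvdn_trans; rewrite dvdn_exp2l. Qed.

Lemma pdvd0 s : pdvd s 0.
Proof. exact: dvdn0. Qed.

Lemma pdvdD s a b : (s <= M)%N -> pdvd s a -> pdvd s b -> pdvd s (a + b).
Proof.
move=> sM /(pdvdP _ sM)[u ->] /(pdvdP _ sM)[v ->].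
by apply/pdvdP => //; exists (u + v); rewrite mulrDr.
Qed.

Lemma pdvdMl s a b : (s <= M)%N -> pdvd s b -> pdvd s (a * b).
Proof.
move=> sM /(pdvdP _ sM)[u ->]; apply/pdvdP => //.
by exists (a * u); rewrite mulrCA.
Qed.

Lemma pdvdB s a b : (s <= M)%N -> pdvd s a -> pdvd s b -> pdvd s (a - b).
Proof. by move=> sM sa sb; rewrite -mulN1r pdvdD ?pdvdMl. Qed.

Lemma pdvd_sum s (I : Type) (r : seq I) (P : pred I) (F : I -> Q) :
  (s <= M)%N -> (forall i, P i -> pdvd s (F i)) ->
  pdvd s (\sum_(i <- r | P i) F i).
Proof.
move=> sM PF; elim/big_ind: _ => //; first exact: pdvd0.
by move=> a b; apply: pdvdD.
Qed.

(** The representatives multiply as natural numbers, where valuations add; since [s <= M], reduction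
    modulo [p ^ M] preserves divisibility by [p ^ s]. *)
Lemma pdvd_cancel s l a b : (s <= M)%N ->
  pdvd s (a * b) -> ~~ pdvd l a -> pdvd (s - l) b.
Proof.
move=> sM; rewrite /pdvd.
have -> : a * b = (nat_of_ord a * nat_of_ord b)%:R by rewrite natrM !natr_Zp.
rewrite val_Zp_nat ?modulus_gt1// /dvdn modn_dvdm ?dvdn_exp2l//.
rewrite -!/(dvdn _ _); move: (nat_of_ord a) (nat_of_ord b) => u v.
have [->|v0] := posnP v; first by rewrite dvdn0.
have [->|u0] := posnP u; first by rewrite dvdn0.
by rewrite !pfactor_dvdn ?muln_gt0 ?u0// lognM//; lia.
Qed.

Lemma pexp_mul_eq0 m z : (m <= M)%N -> p%:R ^+ m * z = 0 -> pdvd (M - m) z.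
Proof.
move=> mM; rewrite -natrX -{1}[z]natr_Zp -natrM => /(congr1 val)/eqP /=.
rewrite -[X in X == _]/(nat_of_ord ((p ^ m * z)%N%:R : Q)).
rewrite val_Zp_nat ?modulus_gt1//.
rewrite -/(dvdn _ _) -{1}(subnKC mM) expnD dvdn_pmul2l//.
by rewrite expn_gt0 prime_gt0.
Qed.

Lemma card_pdvd_ball l t0 : (l <= M)%N ->
  (#|[set t : Q | pdvd l (t - t0)%R]%SET| <= p ^ (M - l))%N.
Proof.
move=> lM; rewrite -[X in (_ <= X)%N]card_ord.
have /subset_leq_card : [set t : Q | pdvd l (t - t0)]%SET \subset
    [set t0 + (p ^ l * nat_of_ord k)%:R | k : 'I_(p ^ (M - l))]%SET.
  apply/fintype.subsetP => t; rewrite inE => /dvdnP[k kE].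
  have kP : (k < p ^ (M - l))%N.
    rewrite -(ltn_pmul2r (m := p ^ l)) ?expn_gt0 ?prime_gt0//.
    rewrite -kE -expnD subnK//.
    by rewrite -[X in (_ < X)%N](Zp_cast modulus_gt1) ltn_ord.
  apply/imsetP; exists (Ordinal kP) => //=.
  by rewrite mulnC -kE natr_Zp addrC subrK.
move/leq_trans; apply; exact: leq_imset_card.
Qed.

(** Synthetic division by [X - x]; the recurrence passes divisibility of the high coefficients from
    [q] to [q1]. *)
Lemma deflate_poly (R : comNzRingType) (q : {poly R}) (x : R) :
  exists q1 : {poly R},
  (forall k, q`_k.+1 = q1`_k - x * q1`_k.+1) /\
  (forall y, q.[y] - q.[x] = (y - x) * q1.[y]).
Proof.
have : root (q - q.[x]%:P) x by rewrite rootE !hornerE subrr.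
case/factor_theorem => q1 E; exists q1; split=> [k|y].
  have /(congr1 (fun r : {poly R} => r`_k.+1)) := E.
  rewrite coefB coefC subr0 mulrBr coefB coefMX => ->.
  by rewrite mulrC coefCM.
have /(congr1 (horner^~ y)) := E.
by rewrite !hornerE mulrC.
Qed.

(* Induction on [K]: once a solution [t0] is known, the solutions outside the
   ball of radius [p ^- l] around it solve a congruence of degree [K - 1]. *)
Lemma card_poly_pdvd e l K s (q : {poly Q}) :
  (e + K * l <= s)%N -> (s <= M)%N ->
  ~~ pdvd e q`_K -> (forall k, (K < k)%N -> pdvd e q`_k) ->
  (#|[set t : Q | pdvd s q.[t]]%SET| <= K * p ^ (M - l))%N.
Proof.
move=> + sM; elim: K s q sM => [|K IHK] s q sM es qK q_gtK.
  (* For [K = 0] every value of [q] is congruent modulo [p ^ e] to the constant coefficient, so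
     there is no solution. *)
  rewrite leqn0 cards_eq0; apply/eqP/setP => t; rewrite !inE.
  apply: contraNF qK => /(pdvd_leq (_ : e <= s)%N) qt.
  have eM : (e <= M)%N by lia.
  have {qt} qt : pdvd e q.[t] by apply: qt; lia.
  have E : q.[t] = q`_0 + \sum_(1 <= i < size q) q`_i * t ^+ i.
    rewrite horner_coef -(big_mkord xpredT (fun i => q`_i * t ^+ i)).
    have [s0|s0] := posnP (size q).
      by rewrite s0 !big_geq// nth_default ?s0// addr0.
    by rewrite big_ltn// expr0 mulr1.
  rewrite -(addrK (\sum_(1 <= i < size q) q`_i * t ^+ i) q`_0) -E pdvdB//.
  rewrite big_nat_cond; apply: pdvd_sum => // i /andP[/andP[i0 _] _].
  by rewrite mulrC pdvdMl ?q_gtK.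
have [->|[t0]] := set_0Vmem [set t : Q | pdvd s q.[t]]%SET;
  first by rewrite cards0.
rewrite inE => t0P; have [q1 [q1E q1h]] := deflate_poly q t0.
have eM : (e <= M)%N by lia.
have lM : (l <= M)%N by lia.
(* Downward induction on [k], starting beyond the size of [q1]. *)
have q1_gtK k : (K < k)%N -> pdvd e q1`_k.
  have [m] := ubnP (size q1 - k); elim: m k => // m IHm k mk Kk.
  have [sk|sk] := leqP (size q1) k; first by rewrite nth_default ?pdvd0.
  have -> : q1`_k = q`_k.+1 + t0 * q1`_k.+1 by rewrite q1E subrK.
  apply: pdvdD => //; first exact: q_gtK.
  by apply: pdvdMl => //; apply: IHm; lia.
have q1K : ~~ pdvd e q1`_K.
  apply: contra qK => q1K; rewrite q1E pdvdB// pdvdMl//; exact: q1_gtK.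
(* Outside the ball, cancelling [t - t0] in [q.[t] - q.[t0]] leaves a congruence on [q1.[t]] modulo
   [p ^ (s - l)]. *)
have sub : [set t : Q | pdvd s q.[t]]%SET \subset
    ([set t : Q | pdvd l (t - t0)] :|: [set t : Q | pdvd (s - l) q1.[t]])%SET.
  apply/fintype.subsetP => t; rewrite !inE => tP.
  case: (boolP (pdvd l (t - t0))) => //= tt0.
  by apply: pdvd_cancel tt0 => //; rewrite -q1h pdvdB.
apply: leq_trans (subset_leq_card sub) _.
apply: leq_trans (leq_card_setU _ _) _.
rewrite mulSn leq_add ?card_pdvd_ball// IHK//; lia.
Qed.

End IntegersModPrimePower.

(** The degree in [t] of the monomial with exponents [i] along the curve [t |-> (t ^ (B ^ k))_k]. *)
Definition wdeg n B (i : 'I_n -> nat) := (\sum_k i k * B ^ k)%N.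

Lemma wdeg_lt n B (i : 'I_n -> nat) :
  (forall k, i k < B)%N -> (wdeg B i < B ^ n)%N.
Proof.
rewrite /wdeg; elim: n i => [|n IHn] i iB; first by rewrite big_ord0.
rewrite big_ord_recr /= expnS.
have := IHn (fun k => i (widen_ord (leqnSn n) k)) (fun k => iB _).
have := iB ord_max; move: (\sum_(_ < _) _)%N => S; nia.
Qed.

(** Uniqueness of the digits in base [B], by division with remainder. *)
Lemma wdeg_inj n B (i j : 'I_n -> nat) :
  (forall k, i k < B)%N -> (forall k, j k < B)%N ->
  wdeg B i = wdeg B j -> i =1 j.
Proof.
rewrite /wdeg; elim: n i j => [|n IHn] i j iB jB ij; first by move=> [].
have E (u : 'I_n.+1 -> nat) : (\sum_(k < n.+1) u k * B ^ k =
    (\sum_(k < n) u (lift ord0 k) * B ^ k) * B + u ord0)%N.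
  rewrite big_ord_recl expn0 muln1 addnC big_distrl /=; congr addn.
  by apply: eq_bigr => k _; rewrite expnSr mulnA.
move: ij; rewrite !E => ij.
have B0 : (0 < B)%N by apply: leq_ltn_trans (iB ord0).
have := congr1 (modn^~ B) ij; have := congr1 (divn^~ B) ij.
rewrite !modnMDl !divnMDl// !(modn_small (iB _)) !(modn_small (jB _)).
rewrite !(divn_small (iB _)) !(divn_small (jB _)) !addn0 => ij' ij0 k.
case: (unliftP ord0 k) => [k' ->|->//].
by apply: (IHn (fun k => i (lift ord0 k)) (fun k => j (lift ord0 k))).
Qed.

Section MonicOfSize.
Variable R : comNzRingType.

Definition monic_deg d (q : {poly R}) := (q \is monic) && (size q == d.+1).

Lemma monic_deg1 : monic_deg 0 1.
Proof. by rewrite /monic_deg monic1 size_poly1. Qed.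

Lemma monic_degM d1 d2 q1 q2 :
  monic_deg d1 q1 -> monic_deg d2 q2 -> monic_deg (d1 + d2) (q1 * q2).
Proof.
move=> /andP[m1 /eqP s1] /andP[m2 /eqP s2]; rewrite /monic_deg.
by rewrite monicMl// m2 size_monicM ?monic_neq0// s1 s2 addnS/= addSn eqxx.
Qed.

Lemma monic_degX d k q : monic_deg d q -> monic_deg (k * d) (q ^+ k).
Proof.
move=> qd; elim: k => [|k IHk]; first by rewrite expr0 monic_deg1.
by rewrite exprS mulSn monic_degM.
Qed.

Lemma monic_deg_prod (I : Type) (r : seq I) (d : I -> nat) (q : I -> {poly R}) :
  (forall i, monic_deg (d i) (q i)) ->
  monic_deg (\sum_(i <- r) d i) (\prod_(i <- r) q i).
Proof.
move=> qd; elim: r => [|i r IHr]; first by rewrite !big_nil monic_deg1.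
by rewrite !big_cons monic_degM.
Qed.

Lemma monic_deg_coef d q k : monic_deg d q -> (d <= k)%N -> q`_k = (k == d)%:R.
Proof.
move=> /andP[/monicP m /eqP s]; rewrite leq_eqVlt eq_sym => /predU1P[->|dk].
  by rewrite eqxx -[RHS]m lead_coefE s.
by rewrite nth_default ?s//; case: ltngtP dk.
Qed.

End MonicOfSize.

Definition mono (R : comNzRingType) n (x : {ffun 'I_n -> R})
    (i : 'I_n -> nat) :=
  \prod_k x k ^+ i k.

(** * Sublevel sets and exponential sums modulo a prime power *)

Section Congruences.
Variables (p : nat) (p_pr : prime p) (M : nat) (M_gt0 : (0 < M)%N).
Local Notation Q := ('Z_(p ^ M)).
Variables (n : nat) (S : {fset {ffun 'I_n -> nat}}).
Local Notation X := {ffun 'I_n -> Q}.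

Definition mpeval (b : {ffun 'I_n -> nat} -> Q) (x : X) : Q :=
  \sum_(i : S) b (val i) * mono x (val i).

(* Translating by the curve [t |-> (t ^ (B ^ k))_k], whose monomials have
   distinct degrees in [t], turns the congruence into congruences in the single
   variable [t] with a leading coefficient independent of [x]. *)
Lemma card_sublevel B e l s (b : {ffun 'I_n -> nat} -> Q) (i0 : S) :
  (0 < B)%N ->
  ~~ pdvd e (b (val i0)) ->
  (forall i : S, i != i0 -> (wdeg B (val i0) <= wdeg B (val i))%N ->
    pdvd e (b (val i))) ->
  (e + wdeg B (val i0) * l <= s)%N -> (s <= M)%N -> (l <= M)%N ->
  (#|[set x : X | pdvd s (mpeval b x)]%SET| * p ^ l <=
     wdeg B (val i0) * #|{: X}|)%N.
Proof.
move=> B0 bi0 bi es sM lM; set K := wdeg B (val i0) in bi es *.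
pose gam (t : Q) : X := [ffun k : 'I_n => t ^+ (B ^ k)].
pose q (x : X) : {poly Q} := \sum_(i : S) (b (val i))%:P *
  \prod_(k < n) ('X^(B ^ k) + (x k)%:P) ^+ (val i k).
have B_gt0 (k : nat) : (0 < B ^ k)%N by rewrite expn_gt0 B0.
have eM : (e <= M)%N by lia.
have qh x t : (q x).[t] = mpeval b (x + gam t).
  rewrite /q horner_sum; apply: eq_bigr => i _; rewrite hornerM hornerC.
  congr (_ * _); rewrite horner_prod; apply: eq_bigr => k _.
  by rewrite horner_exp !hornerE !ffunE addrC.
have md (x : X) (i : S) : monic_deg (wdeg B (val i))
    (\prod_(k < n) ('X^(B ^ k) + (x k)%:P) ^+ (val i k)).
  apply: monic_deg_prod => k; apply: monic_degX.
  by rewrite /monic_deg monicXnaddC// size_XnaddC// eqxx.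
(* From degree [K] on, only [i0] survives modulo [p ^ e]: the other monomials have degree below [K]
   or a coefficient divisible by [p ^ e]. *)
have qcoef x k : (K <= k)%N ->
    pdvd e ((q x)`_k - (b (val i0) *+ (k == K))).
  move=> Kk; rewrite /q coef_sum (bigD1 i0)//= coefCM (monic_deg_coef (md x
    i0))//.
  rewrite -/K mulr_natr addrAC subrr add0r.
  apply: (pdvd_sum p_pr M_gt0) => // i ii0; rewrite coefCM.
  have [iK|Ki] := ltnP (wdeg B (val i)) K.
    by rewrite (monic_deg_coef (md x i)) ?(leq_trans (ltnW iK))//
      gtn_eqF ?mulr0 ?pdvd0// (leq_trans iK).
  by rewrite mulrC; apply: (pdvdMl p_pr M_gt0) => //; exact: bi.
have count x : (#|[set t : Q | pdvd s (q x).[t]]%SET| <= K * p ^ (M - l))%N.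
  apply: (card_poly_pdvd p_pr M_gt0) es sM _ _ => [|k Kk].
    have := qcoef x K (leqnn _); rewrite eqxx mulr1n => H.
    apply: contra bi0 => H'; rewrite -[b _](subKr (q x)`_K).
    exact: (pdvdB p_pr M_gt0).
  by have := qcoef x k (ltnW Kk); rewrite gtn_eqF// mulr0n subr0.
set A := [set x | _]%SET.
(* Double counting of the pairs [(x, t)]: for fixed [t], translation by [gam t] permutes the points,
   so each [t] contributes [#|A|]. *)
have E1 : (\sum_(x : X) #|[set t : Q | pdvd s (q x).[t]]%SET| = p ^ M * #|A|)%N.
  under eq_bigr do rewrite -sum1_card; rewrite (exchange_big_dep xpredT)//=.
  transitivity (#|{: Q}| * #|A|)%N; last by rewrite card_mod.
  rewrite -sum_nat_const; apply: eq_bigr => t _.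
  rewrite -sum1_card [RHS](reindex_inj (addIr (gam t))) /=.
  by apply: eq_bigl => x; rewrite !inE qh.
have E2 : (p ^ M * #|A| <= #|{: X}| * (K * p ^ (M - l)))%N.
  by rewrite -E1 -sum_nat_const; apply: leq_sum => x _; exact: count.
rewrite -(leq_pmul2r (_ : 0 < p ^ (M - l))%N) ?expn_gt0 ?prime_gt0//.
rewrite -mulnA -expnD subnKC// mulnC (leq_trans E2)//.
by rewrite mulnA (mulnC #|_|).
Qed.

Section ExponentialSum.
Variables (C : numDomainType) (chi : Q -> C).
Hypothesis chiD : forall a b, chi (a + b) = chi a * chi b.
Hypothesis chi_norm : forall a, `|chi a| = 1.
Hypothesis chi_ker : forall a, a != 0 -> exists s, chi (a * s) != 1.

(** Orthogonality: shifting [s] by [u] multiplies the sum by [chi (a * u)], which can be chosen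
    different from 1 when [a] is nonzero. *)
Lemma chi_sum a : \sum_(s : Q) chi (a * s) = if a == 0 then #|{: Q}|%:R else 0.
Proof.
have chi0 : chi 0 = 1.
  have c0 : chi 0 != 0 by rewrite -normr_eq0 chi_norm oner_eq0.
  by apply: (mulfI c0); rewrite -chiD addr0 mulr1.
have [->|a0] := eqVneq a 0.
  under eq_bigr do rewrite mul0r chi0.
  by rewrite sumr_const.
have [u u1] := chi_ker a0; set T := \sum_s _.
have : T * chi (a * u) = T.
  rewrite [in RHS]/T (reindex_inj (addIr u)) /= /T big_distrl /=.
  by apply: eq_bigr => s _; rewrite mulrDr chiD.
move/eqP; rewrite -subr_eq0 -[X in _ - X]mulr1 -mulrBr mulf_eq0 subr_eq0.
by rewrite (negPf u1) orbF => /eqP.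
Qed.

(* Replacing [x_j] by [x_j (1 + p^m s)] with [2 m >= M] permutes the points and
   adds [p^m s] times the Euler derivative [x_j d/dx_j] to the phase. *)
Lemma expsum_le_card (c : {ffun 'I_n -> nat} -> Q) (j : 'I_n) m :
  (M <= m.*2)%N -> (m <= M)%N ->
  `|\sum_(x : X) chi (mpeval c x)| <=
  #|[set x : X | pdvd (M - m) (mpeval (fun i => (i j)%:R * c i) x)]%SET|%:R.
Proof.
move=> mM mM'; set th := mpeval (fun i => (i j)%:R * c i).
(* As [2 m >= M], [u s] squares to zero: [1 + u s] has inverse [1 - u s] and its powers are affine
   in [s]. *)
pose u (s : Q) : Q := p%:R ^+ m * s.
have uu s : u s * u s = 0.
  rewrite /u mulrACA -exprD addnn -(subnKC mM) exprD -natrX pchar_Zp ?mul0r//.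
  exact: modulus_gt1.
have uX s k : (1 + u s) ^+ k = 1 + k%:R * u s.
  elim: k => [|k IHk]; first by rewrite expr0 mul0r addr0.
  rewrite exprS IHk; transitivity (1 + k.+1%:R * u s + k%:R * (u s * u s)).
    by rewrite mulrS; ring.
  by rewrite uu mulr0 addr0.
pose sg (s : Q) (x : X) : X := [ffun k =>
  if k == j then x k * (1 + u s) else x k].
have sg_inj s : injective (sg s).
  apply: (can_inj (g := fun x : X => [ffun k =>
    if k == j then x k * (1 - u s) else x k])).
  move=> x; apply/ffunP => k; rewrite !ffunE; case: eqP => // _.
  have E : (1 + u s) * (1 - u s) = 1 by rewrite -[RHS](subr0 1) -(uu s); ring.
  by rewrite -mulrA E mulr1.
have sgE s x : mpeval c (sg s x) = mpeval c x + u s * th x.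
  rewrite /th /mpeval big_distrr -big_split; apply: eq_bigr => i _ /=.
  have -> : mono (sg s x) (val i) = mono x (val i) * (1 + u s) ^+ (val i j).
    rewrite /mono (bigD1 j)//= [in RHS](bigD1 j)//= ffunE eqxx exprMn.
    rewrite mulrAC; congr (_ * _ * _); apply: eq_bigr => k kj.
    by rewrite ffunE (negPf kj).
  rewrite uX; ring.
(* Averaging over [s] kills every point at which [p^m] times the Euler derivative is nonzero. *)
have E : (\sum_(x : X) chi (mpeval c x)) * #|{: Q}|%:R =
    (\sum_(x : X | p%:R ^+ m * th x == 0) chi (mpeval c x)) * #|{: Q}|%:R.
  transitivity (\sum_(s : Q) \sum_(x : X) chi (mpeval c (sg s x))).
    rewrite mulr_natr -sumr_const /=.
    by apply: eq_bigr => s _; rewrite [LHS](reindex_inj (@sg_inj s)).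
  rewrite exchange_big big_distrl [RHS]big_mkcond; apply: eq_bigr => x _ /=.
  transitivity (chi (mpeval c x) * \sum_s chi (p%:R ^+ m * th x * s)).
    rewrite big_distrr; apply: eq_bigr => s _ /=; rewrite sgE chiD.
    by rewrite /u mulrAC.
  by rewrite chi_sum; case: ifP => _; rewrite ?mulr0.
have Q0 : (#|{: Q}|%:R : C) != 0 by rewrite pnatr_eq0 card_ord.
move/(mulIf Q0): E => ->.
apply: le_trans (ler_norm_sum _ _ _) _.
under eq_bigr do rewrite chi_norm.
rewrite sumr_const ler_nat subset_leq_card//.
apply/fintype.subsetP => x; rewrite !inE unfold_in => /eqP.
by move=> /val_inj; apply: (pexp_mul_eq0 p_pr M_gt0).
Qed.

(** Combines [expsum_le_card], for [m] half of [M] rounded up, with [card_sublevel] applied to the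
    coefficients [b] of the Euler derivative. *)
Lemma expsum_le B e l (c : {ffun 'I_n -> nat} -> Q) (i1 : S) (j : 'I_n) :
  (forall k, val i1 k < B)%N -> ~~ pdvd e ((val i1 j)%:R * c (val i1)) ->
  (forall i : S, ~~ [forall k, val i k < B]%N -> pdvd e (c (val i))) ->
  ((e + B ^ n * l).*2 <= M)%N ->
  `|\sum_(x : X) chi (mpeval c x)| * (p ^ l)%:R <= (B ^ n * #|{: X}|)%:R.
Proof.
move=> i1B bi1 cB eM; pose b (i : {ffun 'I_n -> nat}) : Q := (i j)%:R * c i.
have B0 : (0 < B)%N by apply: leq_ltn_trans (i1B j).
have Bn0 : (0 < B ^ n)%N by rewrite expn_gt0 B0.
have e_M : (e <= M)%N by lia.
have box (i : S) : ~~ pdvd e (b (val i)) -> forall k, (val i k < B)%N.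
  move=> bi; apply/forallP; apply: contraR bi => /cB ci.
  exact: (pdvdMl p_pr M_gt0).
(* The exponents with [b] not divisible by [p ^ e] all lie in the box, where weighted degrees are
   distinct; [i0] is the one of largest degree. *)
case: (arg_maxnP (P := fun i : S => ~~ pdvd e (b (val i)))
  (fun i : S => wdeg B (val i)) bi1) => i0 bi0 max_i0.
have i0B := box _ bi0; have i0_lt := wdeg_lt i0B.
have bi (i : S) : i != i0 -> (wdeg B (val i0) <= wdeg B (val i))%N ->
    pdvd e (b (val i)).
  move=> ii0 i0i; apply: contraNT ii0 => /[dup] bi /max_i0 ii0;
    apply/eqP/val_inj.
  apply/ffunP; apply: (wdeg_inj (B := B)) => //; first exact: box.
  by apply/eqP; rewrite eqn_leq; apply/andP; split.
have K_lt := ltnW i0_lt.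
have uM : (uphalf M + M./2 = M)%N by rewrite uphalf_half -addnA addnn
  odd_double_half.
have Ms : (M - uphalf M = M./2)%N by lia.
have lK : (wdeg B (val i0) * l <= B ^ n * l)%N by rewrite leq_mul2r K_lt orbT//.
have ll : (l <= B ^ n * l)%N by rewrite leq_pmull.
have h1 : (M <= (uphalf M).*2)%N by lia.
have h2 : (uphalf M <= M)%N by lia.
have := @expsum_le_card c j (uphalf M) h1 h2; rewrite Ms => hle.
have h3 : (e + wdeg B (val i0) * l <= M./2)%N by lia.
have h4 : (M./2 <= M)%N by lia.
have h5 : (l <= M)%N by lia.
have := card_sublevel B0 bi0 bi h3 h4 h5; rewrite -/b in hle *.
move=> hcard.
apply: le_trans (ler_wpM2r (ler0n _ _) hle) _.
rewrite -natrM ler_nat (leq_trans hcard)// leq_mul2r K_lt orbT//.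
Qed.
End ExponentialSum.
End Congruences.

(** * Tails of restricted power series *)

Section PowerSeriesTails.
Variables (p : nat) (p_pr : prime p).
Local Notation Zp := (padic_int p_pr).
Local Notation Qp := (padic p_pr).
Implicit Types (x z : Qp) (s : int).

(** The fractional ideal [p^s Z_p], that is, the closed ball of radius [p^-s]; [s] may be
    negative. *)
Definition pball s z := exists c : Zp, z = p%:R ^ s * padic_of_int c.

Lemma pball0 s : pball s 0.
Proof. by exists 0; rewrite rmorph0 mulr0. Qed.

Lemma pballD s x z : pball s x -> pball s z -> pball s (x + z).
Proof. by move=> [a ->] [b ->]; exists (a + b); rewrite rmorphD mulrDr. Qed.

Lemma pballMl s (c : Zp) z : pball s z -> pball s (padic_of_int c * z).
Proof. by move=> [b ->]; exists (c * b); rewrite rmorphM mulrCA. Qed.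

Lemma pballN s z : pball s z -> pball s (- z).
Proof. by move=> [b ->]; exists (- b); rewrite rmorphN mulrN. Qed.

Lemma pballB s x z : pball s x -> pball s z -> pball s (x - z).
Proof. by move=> xs zs; apply/pballD/pballN. Qed.

Lemma pball_sum s (I : Type) (r : seq I) (P : pred I) (F : I -> Qp) :
  (forall i, P i -> pball s (F i)) -> pball s (\sum_(i <- r | P i) F i).
Proof.
by move=> PF; elim/big_ind: _ => //; [exact: pball0|exact: pballD].
Qed.

Lemma pballM s t x z : pball s x -> pball t z -> pball (s + t) (x * z).
Proof.
move=> [a ->] [b ->]; exists (a * b).
by rewrite mulrACA -expfzDr ?padic_p_neq0// -rmorphM.
Qed.

Lemma pball_le s t z : s <= t -> pball t z -> pball s z.
Proof.
move=> st [c ->]; have -> : t = s + `|t - s|%N%:Z by lia.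
exists (p%:R ^+ `|t - s| * c).
rewrite expfzDr ?padic_p_neq0// -mulrA; congr (_ * _).
by rewrite rmorphM rmorphXn rmorph_nat exprnP.
Qed.

Lemma pball_exists z : exists s, pball s z.
Proof.
have [->|z0] := eqVneq z 0; first by exists 0; exact: pball0.
have [m zm] := padic_abs_pow rat z0; exists (- m).
by apply/(@padic_abs_le_pow p p_pr rat); rewrite opprK zm.
Qed.

Lemma pball_exists_fin (I : finType) (z : I -> Qp) :
  exists s, forall i, pball s (z i).
Proof.
have [t tP] := all_sig (fun i => cid (pball_exists (z i))).
exists (- (\sum_i `|t i|%N)%N%:Z) => i; apply: pball_le (tP i).
have : (`|t i| <= \sum_i `|t i|)%N by rewrite (bigD1 i)//= leq_addr.
move: (\sum_i _)%N => N; lia.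
Qed.

Lemma nbhs_pball x (A : set Qp) : nbhs x A <->
  exists s : nat, forall z, pball s%:Z z -> A (x + z).
Proof.
split=> [/nbhs_ballP[e /= e0 eA]|[s sA]].
  have [s se] : exists s : nat, (p%:R : rat) ^- s < e.
    have := archi_boundP (ltW (_ : 0 < e^-1)); rewrite invr_gt0 => /(_ e0) h.
    exists (Num.bound e^-1); rewrite invf_plt ?posrE ?exprn_gt0 ?ltr0n
      ?prime_gt0//.
    by apply: lt_trans h _; rewrite -natrX ltr_nat ltn_expl// prime_gt1.
  exists s => z /(@padic_abs_le_pow p p_pr rat) zs; apply: eA.
  rewrite ballEmdist/= -[mdist _ _]/(padic_abs rat (x - (x + z))).
  by rewrite opprD addNKr padic_absN (le_lt_trans zs)// -exprnN.
apply/nbhs_ballP; exists (p%:R ^- s) => /=.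
  by rewrite invr_gt0 exprn_gt0// ltr0n prime_gt0.
move=> z; rewrite ballEmdist/= -[mdist _ _]/(padic_abs rat (x - z)) => /ltW xz.
rewrite -[z](subrK x) addrC; apply: sA.
by apply/(@padic_abs_le_pow p p_pr rat); rewrite -padic_absN opprB -exprnN.
Qed.

Lemma partial_sumE (I : choiceType) (V : zmodType) (F : I -> V) (A : {fset I}) :
  partial_sum F A = \sum_(i <- A) F i.
Proof. by rewrite /partial_sum [RHS]big_seq_fsetE. Qed.

Variable n : nat.
Local Notation expo := {ffun 'I_n -> nat}.

Lemma partial_sum_near (a : power_series p_pr n) (v : 'rV[Qp]_n) s :
  series_cvg a v -> exists S0 : {fset expo}, forall S : {fset expo},
    (S0 `<=` S)%fset ->
    pball s (partial_sum (series_term a v) S - series_eval a v).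
Proof.
move=> /= cva; have [t /= [_ st]] : exists t : int, 0 <= t /\ s <= t.
  by exists `|s|; rewrite normr_ge0 ler_norm.
have /cva : nbhs (series_eval a v)
    [set z | pball s (z - series_eval a v)].
  apply/nbhs_pball; exists `|s|%N => z zs /=; rewrite addrC addKr.
  by apply: pball_le zs; lia.
by move=> [S0 _ S0P]; exists S0 => S /S0P.
Qed.

(** At the point [(1, ..., 1)] the terms are the coefficients themselves, and each is a difference
    of two partial sums close to the limit. *)
Lemma restricted_tail (a : power_series p_pr n) s : restricted a ->
  exists S0 : {fset expo}, forall i, i \notin S0 -> pball s (a i).
Proof.
move=> ra; pose v : 'rV[Qp]_n := const_mx 1.
have vZ : padic_intcube p_pr n v by move=> i; exists 1 => //;
  rewrite mxE rmorph1.
have [S0 S0P] := partial_sum_near s (ra v vZ).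
exists S0 => i iS0; have := pballB (S0P (i |` S0)%fset (fsubsetU1 _ _))
  (S0P S0 (fsubset_refl _)).
rewrite opprB addrA subrK !partial_sumE big_fsetU1//= addrK.
by rewrite /series_term big1 ?mulr1// => k _; rewrite mxE expr1n.
Qed.

Definition intvec (c : 'I_n -> Zp) : 'rV[Qp]_n := \row_k padic_of_int (c k).

Lemma padic_intcubeP (v : 'rV[Qp]_n) :
  padic_intcube p_pr n v <-> exists c, v = intvec c.
Proof.
split=> [vZ|[c ->] k]; last by exists (c k) => //; rewrite mxE.
have [c _ cE] := all_sig2 (fun k => cid2 (vZ k)).
by exists c; apply/rowP => k; rewrite mxE cE.
Qed.

Lemma series_termE (a : power_series p_pr n) c i :
  series_term a (intvec c) i = padic_of_int (\prod_k c k ^+ i k) * a i.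
Proof.
rewrite /series_term mulrC rmorph_prod; congr (_ * _).
by apply: eq_bigr => k _; rewrite mxE rmorphXn.
Qed.

(** At integral points each term outside [S0] lies in the ball, which is closed under addition; a
    larger finite set [S1] reaches the limit. *)
Lemma series_eval_near (a : power_series p_pr n) s (S0 S : {fset expo}) c :
  restricted a -> (forall i, i \notin S0 -> pball s (a i)) ->
    (S0 `<=` S)%fset ->
  pball s (series_eval a (intvec c) - \sum_(i <- S) series_term a (intvec c) i).
Proof.
move=> ra S0P S0S; set v := intvec c.
have vZ : padic_intcube p_pr n v by apply/padic_intcubeP; exists c.
have [S1 S1P] := partial_sum_near s (ra v vZ).
have := S1P (S1 `|` S)%fset (fsubsetUl _ _); rewrite partial_sumE => /pballN.
rewrite opprB => h; rewrite -[X in pball s (X - _)](subrK (\sum_(i <- (S1 `|`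
  S)%fset) series_term a v i)).
rewrite -addrA; apply: pballD => //.
pose F i := if i \in S then series_term a v i else 0.
have -> : \sum_(i <- S) series_term a v i = \sum_(i <- (S1 `|` S)%fset) F i.
  rewrite -(big_fset_incl _ (fsubsetUr S1 S)) => [|i _ iS];
    last by rewrite /F (negPf iS).
  by rewrite !big_seq_fsetE /=; apply: eq_bigr => i _; rewrite /F fsvalP.
rewrite -sumrB; apply: pball_sum => i _; rewrite /F; case: ifPn => iS.
  by rewrite subrr; exact: pball0.
rewrite subr0 series_termE; apply/pballMl/S0P.
by apply: contra iS; apply: (fsubsetP S0S).
Qed.

End PowerSeriesTails.

(** * Characters of the p-adic numbers *)

Section Characters.
Variables (R : realType) (p : nat) (p_pr : prime p).
Local Notation Zp := (padic_int p_pr).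
Local Notation Qp := (padic p_pr).
Local Notation normc := (@ComplexField.Normc.normc R).

Lemma normc_ge0 (z : R[i]) : 0 <= normc z.
Proof. by case: z => a b; exact: sqrtr_ge0. Qed.

(* Squaring multiplies the distance to [1] by at least [3/2] as long as it
   stays below [1/2]. *)
Lemma eq1_small_powers (w : R[i]) :
  (forall k, normc (w ^+ (2 ^ k) - 1) < 2^-1) -> w = 1.
Proof.
move=> small; apply/eqP; rewrite -subr_eq0; apply: contraT => w1.
pose d k := normc (w ^+ (2 ^ k) - 1).
have d0 : 0 < d 0%N.
  by rewrite -ltcR -[(d 0%N)%:C%C]/(`|w ^+ 1 - 1|) expr1 normr_gt0.
have d_ge0 k : 0 <= d k by apply: normc_ge0.
(* Here [z^2 - 1 = (z - 1)(z + 1)] and [|z + 1| >= 2 - |z - 1| >= 3/2]. *)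
have dS k : d k * (3 / 2) <= d k.+1.
  rewrite [d k.+1]/d expnSr exprM; move: (small k) (d_ge0 k).
  rewrite -/(d k) [d k]/d; set z := w ^+ (2 ^ k) => zs zd.
  have -> : z ^+ 2 - 1 = (z - 1) * (z + 1) by ring.
  have two : normc 2%:R = 2 by rewrite normcMn ComplexField.Normc.normc1.
  have := le_normcD (z + 1) (- (z - 1)); rewrite normcN.
  have -> : z + 1 - (z - 1) = 2%:R by ring.
  rewrite two ComplexField.Normc.normcM => h.
  by rewrite ler_wpM2l//; lra.
(* Linear growth is enough: it passes [1/2] once [k] exceeds the inverse of [d 0]. *)
have d_ge k : d 0%N * (1 + k%:R / 2) <= d k.
  elim: k => [|k IHk]; first by rewrite mul0r addr0 mulr1.
  apply: le_trans (dS k); apply: le_trans (ler_wpM2r _ IHk); last by lra.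
  rewrite -mulrA ler_wpM2l// -natr1; have : 0 <= k%:R :> R by [].
  by move: (k%:R) => t; lra.
have := archi_boundP (ltW (_ : 0 < (d 0%N)^-1)); rewrite invr_gt0 => /(_ d0).
set k := Num.bound _; rewrite -div1r ltr_pdivrMr// => dk.
have := d_ge k; have := small k; rewrite -/(d k) => h1 h2.
have : d 0%N * (1 + k%:R / 2) = d 0%N + k%:R * d 0%N / 2 by ring.
lra.
Qed.

Variable psi : Qp -> R[i].
Hypothesis psi_char : additive_character psi.

Lemma additive_charD a b : psi (a + b) = psi a * psi b.
Proof. by case: psi_char. Qed.

Lemma additive_char_norm a : `|psi a| = 1.
Proof. by case: psi_char. Qed.

Lemma additive_char0 : psi 0 = 1.
Proof.
have c0 : psi 0 != 0 by rewrite -normr_eq0 additive_char_norm oner_eq0.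
by apply: (mulfI c0); rewrite -additive_charD addr0 mulr1.
Qed.

(** By continuity a small ball maps near 1; being a subgroup, it maps to elements all of whose
    powers stay near 1. *)
Lemma additive_char_locally_trivial :
  exists s, forall z, pball s z -> psi z = 1.
Proof.
have [cpsi _ _] := psi_char.
have : nbhs (0 : Qp) (psi @^-1` [set w | `|1 - w| < 2^-1]).
  apply: cpsi; rewrite additive_char0; apply/nbhs_ballP; exists 2^-1 => //=.
move=> /nbhs_pball[s sP]; exists s%:Z => z zs; apply: eq1_small_powers => k.
have psiX m : psi (z *+ m) = psi z ^+ m.
  by elim: m => [|m IHm]; rewrite ?mulr0n ?additive_char0 ?expr0//
    mulrS additive_charD IHm exprS.
have /sP : pball s%:Z (z *+ (2 ^ k)).
  by have [c ->] := zs; exists (c *+ (2 ^ k)); rewrite rmorphMn mulrnAr.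
rewrite /= add0r psiX -normrN opprB => h.
rewrite -ltcR; apply: lt_le_trans h _; rewrite -[2]/(2%:R) fmorphV rmorph_nat.
by [].
Qed.

(** A ball on which [psi] is trivial is enlarged one step at a time; this stops before the ball
    contains [a]. *)
Lemma additive_char_conductor : (exists a, psi a != 1) -> exists m : int,
  (forall z, pball m z -> psi z = 1) /\ exists2 z, pball (m - 1) z & psi z != 1.
Proof.
move=> [a a1]; have [s sP] := additive_char_locally_trivial.
pose T k := `[< forall z, pball (s - k%:Z) z -> psi z = 1 >].
have exT : exists k, ~~ T k.
  have [t ta] := pball_exists a; exists `|s - t|%N; apply/asboolPn.
  move=> /(_ a) H; move/eqP: a1; apply; apply: H; apply: pball_le ta; lia.
case: (ex_minnP exT) => -[|k]; first by move=> /asboolPn []; rewrite subr0.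
move=> /asboolPn/existsNP[z /not_implyP[zk zN]] kmin; exists (s - k%:Z); split.
  by apply/asboolP; apply: contraT => /kmin; rewrite ltnn.
exists z; last exact/eqP.
by apply: pball_le zk; lia.
Qed.

End Characters.

(** * Characters of [Z/p^M] induced by [psi] *)

Section FiniteCharacter.
Variables (p : nat) (p_pr : prime p) (M : nat) (M_gt0 : (0 < M)%N).
Local Notation Zp := (padic_int p_pr).
Local Notation Qp := (padic p_pr).
Local Notation Q := ('Z_(p ^ M)).
Let M1 := modulus_gt1 p_pr M_gt0.

Definition residue (c : Zp) : Q := (pseq c M)%:R.

Lemma residueD a b : residue (a + b) = residue a + residue b.
Proof. by rewrite /residue pseqD Zp_nat_mod// natrD. Qed.

Lemma residueM a b : residue (a * b) = residue a * residue b.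
Proof. by rewrite /residue pseqM Zp_nat_mod// natrM. Qed.

Lemma residue_nat m : residue m%:R = m%:R.
Proof. by rewrite /residue pseq_nat Zp_nat_mod. Qed.

Lemma residueX a k : residue (a ^+ k) = residue a ^+ k.
Proof.
elim: k => [|k IHk]; last by rewrite !exprS residueM IHk.
by rewrite !expr0 -[1]/(1%:R) residue_nat.
Qed.

Lemma residue_sum (I : Type) (r : seq I) (F : I -> Zp) :
  residue (\sum_(i <- r) F i) = \sum_(i <- r) residue (F i).
Proof.
elim: r => [|i r IHr]; last by rewrite !big_cons residueD IHr.
by rewrite !big_nil -[0]/(0%:R) residue_nat.
Qed.

Lemma residue_prod (I : Type) (r : seq I) (F : I -> Zp) :
  residue (\prod_(i <- r) F i) = \prod_(i <- r) residue (F i).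
Proof.
elim: r => [|i r IHr]; last by rewrite !big_cons residueM IHr.
by rewrite !big_nil -[1]/(1%:R) residue_nat.
Qed.

Lemma residueK (a : Q) : residue (nat_of_ord a)%:R = a.
Proof. by rewrite residue_nat natr_Zp. Qed.

Lemma val_residue c : residue c = pseq c M :> nat.
Proof. by rewrite /residue val_Zp_nat// pseq_mod. Qed.

Lemma pdvd_residue s c : (s <= M)%N -> pdvd s (residue c) = (pseq c s == 0%N).
Proof. by move=> sM; rewrite /pdvd val_residue /dvdn pseq_modn. Qed.

Lemma residue_eq a b : residue a = residue b -> exists c, a = b + p%:R ^+ M * c.
Proof.
move=> ab; have : pseq (a - b) M == 0%N.
  rewrite -(pdvd_residue _ (leqnn M));
    suff -> : residue (a - b) = 0 by exact: pdvd0.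
  by apply: (addIr (residue b)); rewrite -residueD subrK add0r.
by case/pseq_eq0P => c cE; exists c; rewrite -cE addrC subrK.
Qed.

Variables (R : realType) (psi : Qp -> R[i]).
Hypothesis psi_char : additive_character psi.
Variable m : int.
Hypothesis psi_m : forall z, pball m z -> psi z = 1.
Hypothesis psi_m1 : exists2 z, pball (m - 1) z & psi z != 1.

(** The scaling by [p^(m - M)] sends [p^M Z_p] onto [p^m Z_p], where [psi] is trivial, so the choice
    of representative is immaterial. *)
Definition residue_char (a : Q) : R[i] :=
  psi (p%:R ^ (m - M%:Z) * padic_of_int (nat_of_ord a)%:R).

Lemma residue_charE c :
  residue_char (residue c) = psi (p%:R ^ (m - M%:Z) * padic_of_int c).
Proof.
have [d cE] : exists d, c = (nat_of_ord (residue c))%:R + p%:R ^+ M * d.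
  by apply: residue_eq; rewrite residueK.
rewrite [in RHS]cE rmorphD mulrDr (additive_charD psi_char)
  [X in _ * X]psi_m ?mulr1//.
exists d; rewrite rmorphM rmorphXn rmorph_nat mulrA exprnP -expfzDr
  ?padic_p_neq0//.
by rewrite subrK.
Qed.

Lemma residue_charD a b :
  residue_char (a + b) = residue_char a * residue_char b.
Proof.
rewrite -[a in LHS]residueK -[b in LHS]residueK -residueD residue_charE
  rmorphD mulrDr.
by rewrite (additive_charD psi_char).
Qed.

Lemma residue_char_norm a : `|residue_char a| = 1.
Proof. exact: additive_char_norm. Qed.

(** Writing [a = p^v u] with [u] a unit and [v < M], the multiples of [a] contain [p^(M-1) Z_p]
    modulo [p^M], which the scaling sends onto [p^(m-1) Z_p], where [psi] is nontrivial. *)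
Lemma residue_char_ker a : a != 0 -> exists s, residue_char (a * s) != 1.
Proof.
move=> a0; pose c : Zp := (nat_of_ord a)%:R.
have cM : pseq c M != 0%N.
  by rewrite -val_residue residueK; apply: contra a0 => /eqP h;
    apply/eqP/val_inj.
have c0 : c != 0 by apply: contra_neq cM => ->; rewrite pseq0.
have vM : (padic_int_val c < M)%N by rewrite ltnNge -padic_int_val_le.
have [u cE [w wu]] := padic_int_val_factor c0;
  set v := padic_int_val c in cE vM.
have [z [d zE] z1] := psi_m1.
exists (residue (w * p%:R ^+ (M.-1 - v) * d)).
rewrite -[a]residueK -/c -residueM residue_charE.
suff -> : p%:R ^ (m - M%:Z) * padic_of_int (c * (w * p%:R ^+ (M.-1 - v) * d))
  = z.
  by [].
have -> : c * (w * p%:R ^+ (M.-1 - v) * d) = p%:R ^+ M.-1 * d.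
  have vE : (v + (M.-1 - v) = M.-1)%N by lia.
  have assoc (A : comNzRingType) (x y w' u' d' : A) :
      w' * u' = 1 -> x * u' * (w' * y * d') = x * y * d'.
    by move=> wu'; rewrite -[RHS]mul1r -wu'; ring.
  by rewrite {1}cE -[in RHS]vE exprD assoc.
rewrite rmorphM rmorphXn rmorph_nat mulrA exprnP -expfzDr ?padic_p_neq0// zE.
by congr (_ ^ _ * _); lia.
Qed.

End FiniteCharacter.

(** * Integrals of locally constant functions *)

Section Discretization.
Variables (p : nat) (p_pr : prime p) (n M : nat) (M_gt0 : (0 < M)%N).
Local Notation Zp := (padic_int p_pr).
Local Notation Qp := (padic p_pr).
Local Notation Q := ('Z_(p ^ M)).
Local Notation X := {ffun 'I_n -> Q}.

Definition residue_class (a : X) : set (borel_padic p_pr n) :=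
  [set x | exists2 c, x = intvec c & forall k, residue M (c k) = a k].

Lemma padic_of_int_inj : injective (@padic_of_int p p_pr).
Proof.
move=> a b ab; apply/eqP; rewrite -subr_eq0 -padic_of_int_eq0 rmorphB subr_eq0.
exact/eqP.
Qed.

Lemma intvec_inj (c d : 'I_n -> Zp) : intvec c = intvec d -> c =1 d.
Proof.
by move=> /rowP cd k; have := cd k; rewrite !mxE => /padic_of_int_inj.
Qed.

(** A residue class is open: with [x] it contains [x + p^M Z_p^n]. *)
Lemma measurable_residue_class a : measurable (residue_class a).
Proof.
apply: sub_sigma_algebra; rewrite /= openE => x [c xE cP].
exists (fun _ k => [set z | pball M (z - x ord0 k)]) => [i k|v /= vP].
  rewrite ord1; apply/nbhs_pball; exists M => z zM /=.
  by rewrite addrC addKr.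
have [d dP] := all_sig (fun k => cid (vP ord0 k)).
exists (fun k => c k + p%:R ^+ M * d k).
  apply/rowP => k; rewrite mxE -[LHS](subrK (x ord0 k)) dP xE mxE addrC.
  by rewrite rmorphD rmorphM rmorphXn rmorph_nat exprnP.
move=> k; rewrite (residueD M_gt0) (residueM M_gt0) (residueX M_gt0)
  (residue_nat p_pr M_gt0) -natrX.
by rewrite pchar_Zp ?mul0r ?addr0 ?cP// (modulus_gt1 p_pr).
Qed.

Lemma residue_class_translate a :
  residue_class a = [set intvec (fun k =>
    (nat_of_ord (a k))%:R) + x | x in residue_class 0].
Proof.
apply/seteqP; split=> [_ [c -> cP]|_ [_ [c -> cP] <-]] /=.
  exists (intvec (fun k => c k - (nat_of_ord (a k))%:R)).
    exists (fun k => c k - (nat_of_ord (a k))%:R) => // k.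
    by apply: (addIr (a k)); rewrite -[X in _ + X = _](residueK p_pr M_gt0)
      -(residueD M_gt0) subrK cP ffunE add0r.
  by apply/rowP => k; rewrite !mxE -rmorphD addrC subrK.
exists (fun k => (nat_of_ord (a k))%:R + c k).
  by apply/rowP => k; rewrite !mxE rmorphD.
by move=> k; rewrite (residueD M_gt0) (residueK p_pr M_gt0) cP ffunE addr0.
Qed.

Lemma trivIset_residue_class : trivIset setT residue_class.
Proof.
apply/trivIsetP => a b _ _ ab; apply/seteqP; split=> // x [[c xc ca] [d xd db]].
move/eqP: ab; apply; apply/ffunP => k; rewrite -ca -db.
by congr residue; apply: intvec_inj; rewrite -xc.
Qed.

Lemma bigsetU_residue_class :
  padic_intcube p_pr n = \big[setU/set0]_(a : X) residue_class a :> set _.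
Proof.
apply/seteqP; split=> [x /padic_intcubeP[c xc]|x].
  rewrite (bigD1 [ffun k => residue M (c k)])//=; left.
  by exists c => // k; rewrite ffunE.
elim/big_ind: _ => //[A B IA IB [/IA|/IB]//|a _ [c -> _]].
by apply/padic_intcubeP; exists c.
Qed.

Variables (R : realType) (mu : {measure set (borel_padic p_pr n) -> \bar R}).
Hypothesis mu_haar : normalized_haar mu.

Let integralE (f : borel_padic p_pr n -> R) (h : X -> R) :
  (forall a x, residue_class a x -> f x = h a) ->
  (\int[mu]_(x in padic_intcube p_pr n) (f x)%:E =
   \sum_(a : X) (h a)%:E * mu (residue_class a))%E.
Proof.
move=> fh; rewrite bigsetU_residue_class integral_bigsetU_EFin//.
- by apply: eq_bigr => a _; rewrite -integral_cst//;
  [|exact: measurable_residue_class]; apply: eq_integral => x /set_mem /fh ->.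
- exact: measurable_residue_class.
- exact: index_enum_uniq.
- exact: sub_trivIset trivIset_residue_class.
(* Measurability: inside the cube, a preimage under [f] is a finite union of classes. *)
move=> mD Y mY; rewrite -bigsetU_residue_class.
rewrite (_ : _ `&` _ = \bigcup_(a in [set a | Y (h a)%:E]) residue_class a).
  by apply: fin_bigcup_measurable => // a _; exact: measurable_residue_class.
apply/seteqP; split=> [x [/padic_intcubeP[c xc] Yx]|x [a Ya ax]].
  have cx : residue_class [ffun k => residue M (c k)] x by exists c => // k;
    rewrite ffunE.
  by exists [ffun k => residue M (c k)] => //=; rewrite -(fh _ _ cx).
split; last by rewrite /= (fh _ _ ax).
by case: ax => c -> _; apply/padic_intcubeP; exists c.
Qed.

(** The classes are translates of one another and partition the cube, whose measure 1 is computed by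
    integrating the constant 1. *)
Lemma measure_residue_class a :
  mu (residue_class a) = ((#|{: X}|%:R)^-1 : R)%:E.
Proof.
have [trans mu1] := mu_haar.
have muE b : mu (residue_class b) = mu (residue_class 0).
  by rewrite residue_class_translate trans//; exact: measurable_residue_class.
have mC : measurable (padic_intcube p_pr n : set (borel_padic p_pr n)).
  by rewrite bigsetU_residue_class; apply: bigsetU_measurable => *;
    exact: measurable_residue_class.
have := etrans (esym (integral_cst mu mC 1%:E)) (@integralE (cst 1) (cst 1)
  (fun _ _ _ => erefl)).
rewrite [X in (_ * X)%E]mu1 mul1e; under eq_bigr do rewrite mul1e muE.
have le1 : (mu (residue_class 0%R) <= 1)%E.
  rewrite -mu1; apply: le_measure; rewrite ?inE//;
    first exact: measurable_residue_class.
  by move=> x [c -> _]; apply/padic_intcubeP; exists c.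
have fin : mu (residue_class 0%R) \is a fin_num.
  by rewrite ge0_fin_numE ?measure_ge0// (le_lt_trans le1)// ltry.
rewrite muE -(fineK fin) sumEFin => -[]; rewrite sumr_const => xE; congr EFin.
have X0 : (#|{: X}|%:R : R) != 0.
  by rewrite pnatr_eq0 -lt0n; apply/card_gt0P; exists [ffun=> 0].
by apply: (mulIf X0); rewrite mulVf// mulr_natr xE.
Qed.

Lemma Rintegral_residues (g : 'rV[Qp]_n -> R) (h : X -> R) :
  (forall c, g (intvec c) = h [ffun k => residue M (c k)]) ->
  \int[mu]_(x in padic_intcube p_pr n) g x =
  (\sum_a h a) / #|{: X}|%:R.
Proof.
move=> gh; rewrite /Rintegral (@integralE g h).
  under eq_bigr do rewrite measure_residue_class -EFinM.
  by rewrite sumEFin /= big_distrl.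
by move=> a x [c -> ca]; rewrite gh; congr h; apply/ffunP => k; rewrite ffunE.
Qed.

End Discretization.

(** * Linear independence of the components *)

Section Independence.
Variables (p : nat) (p_pr : prime p) (n r : nat).
Local Notation Zp := (padic_int p_pr).
Local Notation Qp := (padic p_pr).
Local Notation expo := {ffun 'I_n -> nat}.
Variable f : 'I_r -> power_series p_pr n.
Hypothesis f_restricted : forall j, restricted (f j).

Lemma pball_pseq s (c : Zp) : pball s%:Z (padic_of_int c) <-> pseq c s == 0%N.
Proof.
split=> [[d dE]|/pseq_eq0P[d ->]].
  apply/pseq_eq0P; exists d; apply: padic_of_int_inj.
  by rewrite dE rmorphM rmorphXn rmorph_nat.
by exists d; rewrite rmorphM rmorphXn rmorph_nat.
Qed.

Lemma pball_eq0 (z : Qp) : (forall s : nat, pball s%:Z z) -> z = 0.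
Proof.
move=> zs; have [c cE] := zs 0%N; rewrite expr0z mul1r in cE.
rewrite cE; have -> : c = 0; last by rewrite rmorph0.
apply: padic_int_eq => k; rewrite pseq0; apply/eqP/pball_pseq; rewrite -cE.
exact: zs.
Qed.

Lemma pball_scale (k s : int) (z : Qp) :
  pball (k + s) (p%:R ^ k * z) -> pball s z.
Proof.
have pk : (p%:R : Qp) ^ k != 0 by rewrite expfz_neq0 ?padic_p_neq0.
by move=> [c]; rewrite expfzDr ?padic_p_neq0// -mulrA => /(mulfI pk) ->;
  exists c.
Qed.

Lemma restricted_tails s : exists S0 : {fset expo},
  forall j i, i \notin S0 -> pball s (f j i).
Proof.
have [S SP] := all_sig (fun j => cid (restricted_tail s (@f_restricted j))).
exists (\big[fsetU/fset0]_j S j) => j i iS; apply: SP.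
by apply: contra iS => iS; rewrite (bigD1 j)//= inE iS.
Qed.

(** [S0] is chosen before [c], so the approximation is uniform on the cube; the precision [s - t]
    absorbs the denominators of [y]. *)
Lemma series_comb_near (y : 'I_r -> Qp) s : exists S0 : {fset expo},
  forall (S : {fset expo}) c, (S0 `<=` S)%fset ->
  pball s (\sum_j y j * series_eval (f j) (intvec c) -
    \sum_(i <- S) padic_of_int (\prod_k c k ^+ i k) * \sum_j y j * f j i).
Proof.
have [t yt] := pball_exists_fin y.
have [S0 S0P] := restricted_tails (s - t).
exists S0 => S c S0S.
under [X in _ - X]eq_bigr do rewrite big_distrr /=.
rewrite exchange_big /= -sumrB; apply: pball_sum => j _.
have -> : \sum_(i <- S) padic_of_int (\prod_k c k ^+ i k) * (y j * f j i) =
    y j * \sum_(i <- S) series_term (f j) (intvec c) i.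
  by rewrite big_distrr; apply: eq_bigr => i _ /=; rewrite series_termE mulrCA.
rewrite -mulrBr -(subrK t s) addrC; apply: pballM => //.
exact: series_eval_near (S0P j) S0S.
Qed.

Hypothesis f_interior : interior (series_map f @` padic_intcube p_pr n) !=set0.

(** Otherwise the combination is the constant [H] on the cube, and the image of [f] lies in an
    affine hyperplane. *)
Lemma series_independent (w : 'rV[Qp]_r) :
  w != 0 -> exists i, i != [ffun=> 0%N] /\ \sum_j w ord0 j * f j i != 0.
Proof.
move=> w0; apply: contrapT => /forallNP none.
have none' i : i != [ffun=> 0%N] -> \sum_j w ord0 j * f j i = 0.
  by move=> i0; apply/eqP; apply: contraT => h; case: (none i).
pose H := \sum_j w ord0 j * f j [ffun=> 0%N].
have cst_on_cube x : padic_intcube p_pr n x ->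
    \sum_j w ord0 j * series_map f x ord0 j = H.
  move=> /padic_intcubeP[c ->].
  apply/eqP; rewrite -subr_eq0; apply/eqP/pball_eq0 => s.
  have [S0 S0P] := series_comb_near (fun j => w ord0 j) s%:Z.
  have := S0P ([ffun=> 0%N] |` S0)%fset c (fsubsetUr _ _).
  rewrite (big_fsetD1 [ffun=> 0%N]) ?fset1U1//= -/H.
  have P0 : \prod_k c k ^+ ([ffun=> 0%N] : expo) k = 1.
    by rewrite big1// => k _; rewrite ffunE expr0.
  rewrite P0 rmorph1 mul1r.
  rewrite [X in H + X]big_seq [X in H + X]big1 ?addr0; last first.
    by move=> i; rewrite !inE => /andP[i0 _]; rewrite none'// mulr0.
  rewrite (_ : \sum_j w ord0 j * series_map f (intvec c) ord0 j =
    \sum_j w ord0 j * series_eval (f j) (intvec c))//.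
  by apply: eq_bigr => j _; rewrite mxE.
have [z0 /= [P Pnbhs PP]] := f_interior.
have z0P i j : P i j (z0 i j) by apply: nbhs_singleton; exact: Pnbhs.
have /rV0Pn[j0 wj0] := w0.
have /nbhs_pball[s sP] := Pnbhs ord0 j0.
(* A nonzero shift of coordinate [j0], small enough to stay in the image; it changes the combination
   by [w_j0 d]. *)
pose d : Qp := p%:R ^ s%:Z.
have hit (z : 'rV[Qp]_r) : (forall i j, P i j (z i j)) ->
  \sum_j w ord0 j * z ord0 j = H.
  by move=> /PP[x xC <-]; exact: cst_on_cube.
have := hit (\row_j (z0 ord0 j + (if j == j0 then d else 0))).
rewrite -(hit z0)// => E.
have {}E : \sum_j w ord0 j * (\row_j (z0 ord0 j + (if j == j0 then d else 0)))
  ord0 j =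
    \sum_j w ord0 j * z0 ord0 j.
  apply: E => i j; rewrite ord1 mxE; case: eqP => [->|_]; last first.
    by rewrite addr0; exact: z0P.
  by apply: sP; exists 1; rewrite rmorph1 mulr1.
move: E; under eq_bigr do rewrite mxE mulrDr.
rewrite big_split /= => /eqP; rewrite -subr_eq0 addrAC subrr add0r.
rewrite (bigD1 j0)//= eqxx big1 ?addr0 => [|j /negPf ->]; last by rewrite mulr0.
by rewrite mulf_eq0 (negPf wj0) expfz_eq0 (negPf (padic_p_neq0 _)) andbF.
Qed.

Definition coef_mx (t : seq expo) : 'M[Qp]_(r, size t) :=
  \matrix_(j, m) f j (nth [ffun=> 0%N] t m).

Lemma coef_mx_ker (w : 'rV[Qp]_r) t :
  w *m coef_mx t = 0 <-> forall i, i \in t -> \sum_j w ord0 j * f j i = 0.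
Proof.
have E (m : 'I_(size t)) : (w *m coef_mx t) ord0 m =
    \sum_j w ord0 j * f j (nth [ffun=> 0%N] t m).
  by rewrite mxE; apply: eq_bigr => j _; rewrite mxE.
split=> [w0 i /(nthP [ffun=> 0%N])[m mt <-]|w0].
  by rewrite -(E (Ordinal mt)) w0 mxE.
by apply/rowP => m; rewrite E w0 ?mem_nth// mxE.
Qed.

(** As long as the left kernel contains some [w] nonzero, independence supplies an exponent whose
    column excludes [w], and the rank of the kernel drops. *)
Lemma coef_mx_row_free : exists t : seq expo,
  (forall i, i \in t -> i != [ffun=> 0%N]) /\ row_free (coef_mx t).
Proof.
suff H d t : (\rank (kermx (coef_mx t)) <= d)%N ->
    (forall i, i \in t -> i != [ffun=> 0%N]) ->
    exists t : seq expo,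
      (forall i, i \in t -> i != [ffun=> 0%N]) /\ row_free (coef_mx t).
  by apply: (H _ [::] (leqnn _)).
elim: d t => [|d IHd] t rk tN0.
  exists t; split=> //.
  by move: rk; rewrite leqn0 mxrank_eq0 kermx_eq0.
have [k0|kN0] := boolP (row_free (coef_mx t)); first by exists t.
move: kN0; rewrite -kermx_eq0 => /rowV0Pn[w wk w0].
have [i [i0 wi]] := series_independent w0.
apply: (IHd (i :: t)) => [|i']; last first.
  by rewrite inE => /predU1P[->//|]; exact: tN0.
rewrite -ltnS (leq_trans _ rk)//.
have : (kermx (coef_mx (i :: t)) < kermx (coef_mx t))%MS.
  rewrite ltmxE; apply/andP; split.
    apply/rV_subP => u /sub_kermxP/coef_mx_ker uit.
    by apply/sub_kermxP/coef_mx_ker => i' i't; apply: uit; rewrite inE i't orbT.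
  apply: contra wi => /(submx_trans wk)/sub_kermxP/coef_mx_ker wit.
  by apply/eqP/wit; rewrite inE eqxx.
by rewrite ltmxErank => /andP[].
Qed.

(* Coefficients of the combination [\sum_j w_j f_j] scaled by [p ^ - k]. *)
Definition comb_coef (F : 'I_r -> expo -> Zp) (w : 'I_r -> Zp) (i : expo)
    : Zp :=
  \sum_j w j * F j i.

(** Only finitely many coefficients fail to be integral, so they have a common denominator. *)
Lemma integral_coefs : exists k : int, exists F : 'I_r -> expo -> Zp,
  forall j i, f j i = p%:R ^ k * padic_of_int (F j i).
Proof.
have [S0 S0P] := restricted_tails 0.
have [t tP] := pball_exists_fin (fun ji : 'I_r * S0 => f ji.1 (val ji.2)).
pose k := (- (`|t|%N)%:Z).
have /(_ _)/(_ _)/cid : forall j i, pball k (f j i).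
  move=> j i; have [iS|iS] := boolP (i \in S0); last first.
    by apply: pball_le (S0P j i iS); rewrite /k; lia.
  by apply: pball_le (tP (j, [` iS]%fset)); rewrite /k; lia.
by move=> h; exists k, (fun j i => sval (h j i)) => j i; exact: (svalP (h j i)).
Qed.

(* The bound is uniform over the primitive [w], although there are infinitely
   many of them, because finitely many coefficients of the combination already
   recover [w] through a fixed matrix. *)
Lemma uniform_coefs (k : int) (F : 'I_r -> expo -> Zp) :
  (forall j i, f j i = p%:R ^ k * padic_of_int (F j i)) ->
  exists e B : nat,
    (forall w : 'I_r -> Zp, (exists j, pseq (w j) 1 != 0%N) ->
      exists (i : expo) l, (forall m, i m < B)%N /\
        pseq ((i l)%:R * comb_coef F w i) e != 0%N) /\
    (forall j (i : expo), ~~ [forall m, i m < B]%N -> pseq (F j i) e = 0%N).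
Proof.
move=> fF; have [t [tN0 free]] := coef_mx_row_free.
pose L := pinvmx (coef_mx t).
have [c' Lc'] := pball_exists_fin (fun jm : 'I_(size t) * 'I_r => L jm.1 jm.2).
pose c := `|c'|%N.
have Lc m j : pball (- c%:Z) (L m j).
  by apply: pball_le (Lc' (m, j)); rewrite /c; lia.
(* [L] is a right inverse of the coefficient matrix: it loses at most [c] digits and [p^k] at most
   [|k|], so one more digit forces [p] to divide [w]. *)
have recover (w : 'I_r -> Zp) : (exists j, pseq (w j) 1 != 0%N) ->
    exists2 i, i \in t & pseq (comb_coef F w i) (c + `|k|).+1 != 0%N.
  move=> [j wj]; apply: contrapT => none.
  have {}none i : i \in t -> pseq (comb_coef F w i) (c + `|k|).+1 == 0%N.
    by move=> it; apply: contraT => h; case: none; exists i.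
  move/negP: wj; apply; apply/pball_pseq.
  pose v : 'rV[Qp]_r := \row_j padic_of_int (w j).
  have <- : v ord0 j = padic_of_int (w j) by rewrite mxE.
  rewrite -[v]mulmx1 -(mulmxVp free) mulmxA mxE; apply: pball_sum => m _.
  apply: (pball_le (t := (k + (c + `|k|).+1%:Z) + (- c%:Z))); first by lia.
  apply: pballM; last exact: Lc.
  rewrite mxE (eq_bigr (fun j => p%:R ^ k * padic_of_int (w j * F j (nth
    [ffun=> 0%N] t m)))).
    rewrite -big_distrr -rmorph_sum /=; set C := \sum_j _.
    have /pball_pseq[d dE] : pseq C (c + `|k|).+1 == 0%N by apply: none;
      exact: mem_nth.
    by exists d; rewrite dE mulrA -expfzDr ?padic_p_neq0.
  by move=> j' _; rewrite !mxE fF rmorphM mulrCA.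
pose W := (\sum_(i <- t) \sum_m i m)%N.
have W_ge (i : expo) m : i \in t -> (i m <= W)%N.
  move=> it; rewrite /W (perm_big _ (perm_to_rem it))
    big_cons (bigD1 m)//= -addnA.
  exact: leq_addr.
clearbody W c.
(* The summand [W] pays for the factor [i l <= W] of the Euler derivative. *)
pose e := (W + (c + `|k|).+1)%N.
have [S SP] := restricted_tails (k + e%:Z).
(* [B] exceeds all exponents occurring in [t] and in [S], so an index outside the box is outside
   [S]. *)
pose B := (W + \sum_(i <- S) \sum_m i m).+1.
exists e, B; split=> [w /recover[i it wi]|j i].
  have [l il] : exists l, i l != 0%N.
    apply: contrapT => none; have /eqP[] := tN0 i it; apply/ffunP => l.
    by rewrite ffunE; apply/eqP; apply: contraT => h; case: none; exists l.
  exists i, l; split=> [m|]; first by rewrite /B ltnS (leq_trans (W_ge i m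
    it))// leq_addr.
  have il0 : (0 < i l)%N by rewrite lt0n.
  have := pseq_natl_neq0 p_pr il0; rewrite -{2}(prednK il0) => iln.
  apply: contra (pseq_mul_neq0 iln wi) => /eqP h; apply/eqP.
  by apply: pseq_le0 h; rewrite /e -addnS leq_add2r (leq_trans (leq_pred _))//
    W_ge.
move=> ibox; apply/eqP/pball_pseq/(pball_scale (k := k)); rewrite -fF;
  apply: SP.
apply: contra ibox => iS; apply/forallP => m; rewrite /B ltnS.
rewrite (perm_big _ (perm_to_rem iS)) big_cons (bigD1 m)//=.
by rewrite addnCA -addnA leq_addr.
Qed.

End Independence.

(** * Decay of the exponential integral *)

Section Decay.
Variables (R : realType) (p : nat) (p_pr : prime p) (n r : nat).
Local Notation Zp := (padic_int p_pr).
Local Notation Qp := (padic p_pr).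
Local Notation expo := {ffun 'I_n -> nat}.
Local Notation normc := (@ComplexField.Normc.normc R).
Variable mu : {measure set (borel_padic p_pr n) -> \bar R}.
Hypothesis mu_haar : normalized_haar mu.
Variable f : 'I_r -> power_series p_pr n.
Hypothesis f_restricted : forall j, restricted (f j).
Variable psi : Qp -> R[i].
Hypothesis psi_char : additive_character psi.
Variable m : int.
Hypothesis psi_m : forall z, pball m z -> psi z = 1.
Hypothesis psi_m1 : exists2 z, pball (m - 1) z & psi z != 1.

(** Modulo [p^m Z_p], where [psi] is trivial, the phase is a polynomial depending only on [x] modulo
    [p^M]. [S1] lets a chosen exponent be kept in the sum. *)
Lemma exp_integral_finite (y : 'rV[Qp]_r) M (G : expo -> Zp)
    (S1 : {fset expo}) :
  (0 < M)%N ->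
  (forall i, \sum_j y ord0 j * f j i =
    p%:R ^ (m - M%:Z) * padic_of_int (G i)) ->
  exists2 S : {fset expo}, (S1 `<=` S)%fset &
    exp_integral mu psi f y =
    (\sum_x residue_char psi m (mpeval S (fun i => residue M (G i)) x)) /
    #|{: {ffun 'I_n -> 'Z_(p ^ M)}}|%:R.
Proof.
move=> M0 yG; have [S0 S0P] := series_comb_near f_restricted (fun j =>
  y ord0 j) m.
exists (S0 `|` S1)%fset; first exact: fsubsetUr.
set S := (S0 `|` S1)%fset.
pose h (x : {ffun 'I_n -> 'Z_(p ^ M)}) :=
  residue_char psi m (mpeval S (fun i => residue M (G i)) x).
have gh c : psi (\sum_(j < r) y ord0 j * series_eval (f j) (intvec c)) =
    h [ffun k => residue M (c k)].
  have := S0P S c (fsubsetUl _ _).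
  rewrite (eq_bigr (fun i : expo =>
    p%:R ^ (m - M%:Z) * padic_of_int (\prod_k c k ^+ i k * G i))); last first.
    by move=> i _; rewrite yG mulrCA rmorphM.
  rewrite -big_distrr -rmorph_sum /=; set T := \sum_(i <- S) _ => near.
  rewrite -[X in psi X](subrK (p%:R ^ (m - M%:Z) * padic_of_int T)).
  rewrite (additive_charD psi_char) psi_m//
    mul1r -(residue_charE M0 psi_char psi_m).
  rewrite /h; congr residue_char;
    rewrite /T (residue_sum M0) /mpeval big_seq_fsetE /=.
  apply: eq_bigr => i _; rewrite (residueM M0) mulrC; congr (_ * _).
  rewrite (residue_prod M0); apply: eq_bigr => k _.
  by rewrite (residueX M0) ffunE.
rewrite /exp_integral.
rewrite (@Rintegral_residues p p_pr n M M0 R mu mu_haar _ (fun x =>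
  complex.Re (h x))); last first.
  by move=> c; rewrite gh.
rewrite (@Rintegral_residues p p_pr n M M0 R mu mu_haar _ (fun x =>
  complex.Im (h x))); last first.
  by move=> c; rewrite gh.
have -> : \sum_x h x = ((\sum_x complex.Re (h x))
  +i* (\sum_x complex.Im (h x)))%C.
  by elim/big_rec3: _ => [//|x a b c _ ->]; case: (h x) => u v; simpc.
set N := #|_|; have N0 : (N%:R : R[i]) != 0.
  by rewrite pnatr_eq0 -lt0n; apply/card_gt0P; exists [ffun=> 0].
have NR0 : (N%:R : R) != 0 by move: N0; rewrite !pnatr_eq0.
apply: (mulIf N0); rewrite divfK// -(rmorph_nat (real_complex R)) /=.
by simpc; rewrite !divfK.
Qed.

Lemma normcE (z : R[i]) : (normc z)%:C%C = `|z|.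
Proof. by []. Qed.

Lemma normc_div_nat (z : R[i]) (N : nat) :
  normc (z / N%:R) = normc z / N%:R.
Proof.
have -> : z / N%:R = z * (N%:R^-1)%:C%C by rewrite fmorphV rmorph_nat.
rewrite ComplexField.Normc.normcM; congr (_ * _); apply: complexI.
rewrite normcE ger0_norm// ler0c invr_ge0//.
Qed.

Lemma exp_integral_le1 (y : 'rV[Qp]_r) : normc (exp_integral mu psi f y) <= 1.
Proof.
have [k [F fF]] := integral_coefs f_restricted.
(* [M] is taken large enough that [p^(m - M)] divides all coefficients of the phase. *)
have [t yt] := pball_exists_fin (fun j => y ord0 j).
have [d dP] := all_sig (fun j => cid (yt j)).
pose M := (`|m| + `|t| + `|k|)%N.+1.
pose a := absz (t + k - m + M%:Z)%R.
have aE : (t + k = (m - M%:Z) + a%:Z)%R by rewrite /a /M; lia.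
have yG i : \sum_j y ord0 j * f j i =
    p%:R ^ (m - M%:Z) * padic_of_int (p%:R ^+ a * comb_coef F d i).
  rewrite rmorphM rmorphXn rmorph_nat mulrA exprnP -expfzDr ?padic_p_neq0// -aE.
  rewrite rmorph_sum big_distrr /=; apply: eq_bigr => j _.
  by rewrite dP fF rmorphM expfzDr ?padic_p_neq0// mulrACA.
have M0 : (0 < M)%N by [].
have [S _ ->] := exp_integral_finite fset0 M0 yG.
rewrite normc_div_nat ler_pdivrMr ?mul1r; last first.
  by rewrite ltr0n; apply/card_gt0P; exists [ffun=> 0].
rewrite -lecR rmorph_nat normcE.
apply: le_trans (ler_norm_sum _ _ _) _.
under eq_bigr do rewrite (residue_char_norm psi_char).
by rewrite sumr_const.
Qed.

Lemma exp_integral_decay : 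
  interior (series_map f @` padic_intcube p_pr n) !=set0 ->
  exists (A : int) (K : nat), (0 < K)%N /\
  forall (y : 'rV[Qp]_r) (v : int) (w : 'I_r -> Zp) (l : nat),
    (forall j, y ord0 j = p%:R ^ (- v) * padic_of_int (w j)) ->
    (exists j, pseq (w j) 1 != 0%N) ->
    A + (2 * K * l)%N%:Z <= v ->
    normc (exp_integral mu psi f y) <= K%:R / p%:R ^+ l.
Proof.
move=> f_interior; have [k [F fF]] := integral_coefs f_restricted.
have [e [B [eB1 eB2]]] := uniform_coefs f_restricted f_interior fF.
(* With [M = m + v - k], this [A] gives [M > 2 (e + B^n l)]; the successor keeps [K] positive. *)
exists (k - m + (2 * e)%N%:Z + 1), (B ^ n).+1%N; split=> // y v w l yw w1 vl.
have [i1 [j [i1B ij]]] := eB1 w w1.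
pose M := absz (m + v - k)%R.
have ME : m + v - k = M%:Z by rewrite /M; lia.
have MB : ((e + B ^ n * l).*2 < M)%N.
  move: (B ^ n)%N vl ME => b; rewrite /M; nia.
have M0 : (0 < M)%N by lia.
have yG i : \sum_j y ord0 j * f j i =
    p%:R ^ (m - M%:Z) * padic_of_int (comb_coef F w i).
  have -> : m - M%:Z = - v + k by rewrite -ME; ring.
  rewrite rmorph_sum big_distrr /=; apply: eq_bigr => j' _.
  by rewrite yw fF rmorphM expfzDr ?padic_p_neq0// mulrACA.
have [S i1S ->] := exp_integral_finite [fset i1]%fset M0 yG.
have {}i1S : i1 \in S by apply: (fsubsetP i1S); rewrite inE.
have eM : (e <= M)%N by lia.
have h1 : ~~ pdvd e ((i1 j)%:R * residue M (comb_coef F w i1)).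
  by rewrite -(residue_nat p_pr M0) -(residueM M0) (pdvd_residue M0).
have h2 (i : S) : ~~ [forall k, val i k < B]%N ->
  pdvd e (residue M (comb_coef F w (val i))).
  move=> ibox; rewrite (pdvd_residue M0)//; apply/pball_pseq.
  rewrite rmorph_sum; apply: pball_sum => j' _; rewrite rmorphM.
  by apply/pballMl/pball_pseq; rewrite eB2.
have := @expsum_le p p_pr M M0 n S _ (residue_char psi m)
  (residue_charD M0 psi_char psi_m)
  (residue_char_norm psi_char m) (residue_char_ker M0 psi_char psi_m psi_m1)
  B e l (fun i => residue M (comb_coef F w i))
    [` i1S]%fset j i1B h1 h2 (ltnW MB).
rewrite normc_div_nat; set T := \sum_x _; set N := #|_| => h.
have N0 : (0 < N%:R :> R) by rewrite ltr0n; apply/card_gt0P; exists [ffun=> 0].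
have {}h : normc T * (p ^ l)%:R <= (B ^ n * N)%:R.
  by rewrite -lecR rmorphM /= !rmorph_nat normcE.
have pl : 0 < p%:R ^+ l :> R by rewrite exprn_gt0// ltr0n prime_gt0.
rewrite ler_pdivrMr// mulrAC ler_pdivlMr// -natrX -natrM (le_trans h)//.
by rewrite ler_nat leq_mul2r leqnSn orbT.
Qed.

End Decay.

(** * Normalization of [y] and the power bound *)

Lemma primitive_vector (R : realType) (p : nat) (p_pr : prime p) (r : nat)
    (y : 'rV[padic p_pr]_r) : y != 0 ->
  exists (v : int) (w : 'I_r -> padic_int p_pr),
    [/\ vec_abs R y = p%:R ^ v,
        forall j, y ord0 j = p%:R ^ (- v) * padic_of_int (w j)
      & exists j, pseq (w j) 1 != 0%N].
Proof.
move=> /rV0Pn[j1 yj1].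
have E : vec_abs R y = padic_abs R (y ord0 [arg max_(j > j1)
  padic_abs R (y ord0 j)]%O).
  by apply: bigmax_eq_arg => // j _; exact: padic_abs_ge0.
move: E; case: arg_maxP => //= j0 _ j0max E.
have yj0 : y ord0 j0 != 0.
  rewrite -(padic_abs_eq0 R) gt_eqF// (lt_le_trans _ (j0max j1 isT))//.
  by rewrite lt_def padic_abs_eq0 yj1 padic_abs_ge0.
have [v yv] := padic_abs_pow R yj0.
have yw j : exists w, y ord0 j = p%:R ^ (- v) * padic_of_int w.
  apply/(@padic_abs_le_pow p p_pr R); rewrite opprK -yv; exact: j0max.
have [w wP] := all_sig (fun j => cid (yw j)).
exists v, w; split=> //; first by rewrite E.
(* If [p] divided the coordinate at the maximum, its absolute value would be at most [p^(v - 1)]. *)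
exists j0; apply/negP => /pball_pseq[d dE].
have : padic_abs R (y ord0 j0) <= p%:R ^ (- (1 - v)).
  apply/padic_abs_le_pow; exists d;
    rewrite wP dE mulrA -expfzDr ?padic_p_neq0//.
  by rewrite addrC.
rewrite yv opprB ler_eXz2l ?ltr1n ?prime_gt1//.
lia.
Qed.

(** Gaining a factor [P] each time [v] grows by [2 K] is decay with exponent [alpha = -1 / (2 K)];
    rounding [l] down costs one factor [P], absorbed in [c]. *)
Lemma power_decay (R : realType) (P : R) (K : nat) (A : int) :
  1 < P -> (0 < K)%N ->
  exists alpha c : R, [/\ alpha < 0, 0 < c, 1 <= c &
    forall (v : int) (E : R), E <= 1 ->
      (forall l : nat, A + (2 * K * l)%N%:Z <= v -> E <= K%:R / P ^+ l) ->
      E <= c * (P ^ v) `^ alpha].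
Proof.
move=> P1 K0; have P0 : 0 < P by apply: lt_trans P1.
pose D : R := (2 * K)%:R.
have D0 : 0 < D by rewrite ltr0n muln_gt0.
pose alpha := - D^-1.
have a0 : alpha < 0 by rewrite oppr_lt0 invr_gt0.
have K1 : 1 <= K%:R :> R by rewrite ler1n.
pose c := 1 + K%:R * P `^ (1 - alpha * A%:~R).
have c1 : 1 <= c by rewrite lerDl mulr_ge0// powR_ge0.
exists alpha, c; split=> //; first exact: lt_le_trans c1.
move=> v E E1 El.
rewrite -powR_intmul ?(ltW P0)// -powRrM.
apply: (@le_trans _ _ (K%:R * P `^ (1 + alpha * (v - A)%:~R))); last first.
  rewrite rmorphB mulrBr [v%:~R * _]mulrC /=.
  have -> : 1 + (alpha * v%:~R - alpha * A%:~R) = (1 - alpha * A%:~R)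
    + alpha * v%:~R by ring.
  rewrite powRD ?(gt_eqF P0) ?implybT// mulrA ler_wpM2r ?powR_ge0//.
  by rewrite lerDr.
(* Below [A] the trivial bound suffices, since the exponent on the right is positive. *)
have [vA|Av] := ltP v A.
  apply: le_trans E1 _; rewrite -[X in X <= _]mul1r ler_pM//.
  have z0 : 0 <= alpha * (v - A)%:~R by rewrite nmulr_rge0// lerz0; lia.
  by rewrite -[X in X <= _](powRr0 P) ler_powR ?(ltW P1)// addr_ge0.
pose l := (absz (v - A)%R %/ (2 * K))%N.
have vAE : v - A = (absz (v - A)%R)%:Z by lia.
have lD : (absz (v - A)%R < l.+1 * (2 * K))%N by rewrite -ltn_divLR ?muln_gt0.
have lD' : (l * (2 * K) <= absz (v - A)%R)%N by apply: leq_trunc_div.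
apply: le_trans (El l _) _; first by move: lD' vAE;
  rewrite [X in (X <= _)%N]mulnC; move: (2 * K * l)%N => q; lia.
rewrite ler_wpM2l// -powR_invn ?(ltW P0)// ler_powR ?(ltW P1)//.
have : D^-1 * (absz (v - A)%R)%:R <= l.+1%:R.
  by rewrite ler_pdivrMl// mulrC -natrM ler_nat ltnW.
rewrite vAE /alpha mulNr -[(Posz _)%:~R]/((absz (v - A)%R)%:R) -natr1.
by move: (D^-1 * _) => q; lra.
Qed.

Theorem theorem1p1 (R : realType) (p : nat) (p_pr : prime p) (n r : nat)
    (mu : {measure set (borel_padic p_pr n) -> \bar R})
    (f : 'I_r -> power_series p_pr n) (psi : padic p_pr -> R[i]) :
  normalized_haar mu ->
  (forall j, restricted (f j)) ->
  additive_character psi -> (exists a, psi a != 1) ->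
  interior (series_map f @` padic_intcube p_pr n) !=set0 ->
  exists alpha c : R, [/\ alpha < 0, 0 < c &
    forall y : 'rV[padic p_pr]_r,
      ((ComplexField.Normc.normc (exp_integral mu psi f y))%:E <=
         c%:E * Order.min (powR_pinfty (vec_abs R y) alpha) 1)%E].
Proof.
move=> haar fr psi_char psi_nontriv f_int.
have [m [psi_m psi_m1]] := additive_char_conductor psi_char psi_nontriv.
have [A [K [K0 decay]]] := exp_integral_decay haar fr psi_char psi_m psi_m1
  f_int.
have p1 : 1 < p%:R :> R by rewrite ltr1n prime_gt1.
have [alpha [c [a0 c0 c1 bound]]] := power_decay A p1 K0.
exists alpha, c; split=> // y.
have E1 := exp_integral_le1 haar fr psi_char psi_m y.
set E := ComplexField.Normc.normc _ in E1 *.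
have Ec : E <= c by apply: le_trans c1.
(* At [y = 0] the power is [+oo], so the minimum is 1 and [1 <= c] concludes. *)
have [->|y0] := eqVneq y 0.
  have -> : vec_abs R (0 : 'rV[padic p_pr]_r) = 0.
    rewrite /vec_abs; elim/big_rec: _ => // j x _ ->; rewrite mxE.
    by have /eqP -> : padic_abs R (0 : padic p_pr) == 0;
      rewrite ?padic_abs_eq0 ?maxxx.
  by rewrite /powR_pinfty eqxx min_r ?leey// mule1 lee_fin.
have [v [w [yv yw w1]]] := primitive_vector R y0.
rewrite /powR_pinfty yv expfz_eq0 (gt_eqF (lt_trans _ p1))// andbF.
rewrite -EFin_min -EFinM lee_fin minr_pMr ?(ltW c0)// mulr1 le_min Ec andbT.
by apply: bound => // l Al; exact: decay yw w1 Al.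
Qed.
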